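(* Let $\Delta\subseteq\mathbb R^n$ be a pure and hereditary $n$-dimensional simplicial complex, fix $0\le i\le n-2$, and let $\mathbf r=\{r_\tau:\tau\in\Delta_{n-1}^\circ\}$ and $\mathbf s=\{s_\beta:\beta\in\Delta_i\}$ be families of non-negative integers with $0\le r_\tau\le s_\beta$ for each $\tau\in\Delta_{n-1}^\circ$ and each $\beta\in\Delta_i^\circ$. Then $$\mathcal S^{\mathbf r,\mathbf s}(\hat\Delta)\cong\ker(\overline\partial_n),$$ where $\mathcal S^{\mathbf r,\mathbf s}(\hat\Delta)$ is the set of splines on the cone $\hat\Delta$ with smoothness $\mathbf r$ across the faces $\hat\tau$ and supersmoothness $\mathbf s$ at the $(i+1)$-faces $\hat\beta$, and $$\overline\partial_n:\bigoplus_{\sigma\in\Delta_n}S[\sigma]\longrightarrow\bigoplus_{\tau\in\Delta_{n-1}^\circ}S/J(\tau),\qquad S=\mathbb R[x_0,\dots,x_n],$$ is the map induced by the simplicial boundary map of $\Delta$ relative to its boundary $\partial\Delta$.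
   Context: $\Delta_j$ is the set of $j$-dimensional faces of $\Delta$ and $\Delta_j^\circ$ the subset of interior ones. $\Delta$ is pure if all its maximal faces have dimension $n$. $\Delta$ is hereditary if for all $\sigma,\sigma'\in\Delta_n$ whose intersection $\beta=\sigma\cap\sigma'$ is a (nonempty) face of $\Delta$, of any dimension, there is a sequence $\sigma=\sigma_0,\dots,\sigma_m=\sigma'$ of $n$-faces all containing $\beta$ with $\sigma_{k-1}\cap\sigma_k\in\Delta_{n-1}^\circ$ for each $k=1,\dots,m$. Embed $\mathbb R^n$ in $\mathbb R^{n+1}$ (coordinates $x_0,\dots,x_n$) as the hyperplane $x_0=1$ via $\phi(x_1,\dots,x_n)=(1,x_1,\dots,x_n)$. For a simplex $\beta$, $\hat\beta$ is the convex hull of the origin of $\mathbb R^{n+1}$ and $\phi(\beta)$; the cone $\hat\Delta$ is the simplicial complex consisting of the simplices $\hat\beta$, $\beta\in\Delta$, together with the origin. $\mathcal S^{\mathbf r,\mathbf s}(\hat\Delta)$ is the set of continuous piecewise polynomial functions $f$ on $\hat\Delta$ (with $f|_{\hat\sigma}\in S$ for each $\sigma\in\Delta_n$) such that $f$ is $C^{r_\tau}$ on the union of the two $(n+1)$-simplices containing $\hat\tau$, for each $\tau\in\Delta_{n-1}^\circ$, and such that for each $\beta\in\Delta_i$ the polynomials $f|_{\hat\sigma}$, for all $\sigma\in\Delta_n$ having $\beta$ as a face, have common derivatives up to order $s_\beta$ on the $(i+1)$-face $\hat\beta$. For $\tau\in\Delta_{n-1}^\circ$, let $\ell_\tau\in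 S$ be a nonzero linear form vanishing on $\hat\tau$; for $\beta\in\Delta_i$, let $\hat{\mathfrak m}_\beta\subset S$ be the ideal generated by the homogenizations (with respect to $x_0$) of the polynomials in $\mathbb R[x_1,\dots,x_n]$ vanishing on $\beta$. Then $$J(\tau)=\langle\ell_\tau^{\,r_\tau+1}\rangle\cap\bigcap_{\beta\in\Delta_i,\ \beta\subset\tau}\hat{\mathfrak m}_\beta^{\,s_\beta+1}.$$ Concretely, the $\tau$-component of $\overline\partial_n\bigl((f_\sigma)_\sigma\bigr)$ is, up to sign, the class of $f_\sigma-f_{\sigma'}$, where $\sigma,\sigma'$ are the two $n$-faces with $\sigma\cap\sigma'=\tau$.
   Formalization: The complex Δ is additionally assumed connected: for two disjoint n-simplices the kernel is S⊕S, while splines on the cone must agree at the common cone point, giving S⊕⟨x_0,…,x_n⟩, which is not isomorphic to it. *)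

(* Defs.v *)
From HB Require Import structures.
From mathcomp Require Import all_boot all_order all_algebra.
From mathcomp Require Import all_classical all_reals all_analysis.
(* The notations of mpoly clash with those of MathComp-Analysis: polynomials in
   n variables are written [mpoly n R]. *)
From mathcomp Require Import -(notations) mpoly.

Set Implicit Arguments.
Unset Strict Implicit.
Unset Printing Implicit Defensive.

Import Order.TTheory GRing.Theory Num.Theory.
Import numFieldNormedType.Exports.

Local Open Scope classical_set_scope.
Local Open Scope ring_scope.

Definition conv_hull (R : realType) (m : nat) (A : set 'rV[R]_m) : set 'rV[R]_m :=
  [set x | exists k (w : 'I_k -> R) (p : 'I_k -> 'rV[R]_m),
     [/\ forall j, 0 <= w j, \sum_(j < k) w j = 1, forall j, A (p j)
       & x = \sum_(j < k) w j *: p j]].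

(* A simplex is represented by its set of vertices, and its points are
   [conv_hull (pos @` [set` b])]. An element of [vertex] that lies in no face
   plays no role. The empty set is not a face. *)
Record simplicial_complex (R : realType) (n : nat) := SimplicialComplex {
  vertex :> finType;
  pos : vertex -> 'rV[R]_n;
  faces : {set {set vertex}};
  faces_neq0 : forall b, b \in faces -> b != finset.set0;
  faces_sub : forall b c : {set vertex},
    c \in faces -> b \subset c -> b != finset.set0 -> b \in faces;
  faces_affine_free : forall b, b \in faces ->
    forall w : vertex -> R, \sum_(v in b) w v = 0 ->
      \sum_(v in b) w v *: pos v = 0 -> forall v, v \in b -> w v = 0;
  faces_inter : forall b c, b \in faces -> c \in faces ->
    conv_hull (pos @` [set` b]) `&` conv_hull (pos @` [set` c]) =
    conv_hull (pos @` [set` b :&: c])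
}.

Section Complex.
Variables (R : realType) (n : nat) (D : simplicial_complex R n).

Definition simplex (b : {set D}) : set 'rV[R]_n := conv_hull (@pos _ _ D @` [set` b]).

Definition polyhedron : set 'rV[R]_n := \bigcup_(b in [set` faces D]) simplex b.

Definition jfaces (j : nat) : {set {set D}} := [set b in faces D | #|b| == j.+1].

(* Generated by the (n-1)-faces that lie in exactly one n-face. *)
Definition boundary : {set {set D}} :=
  [set b in faces D | [exists t in jfaces n.-1,
     (b \subset t) && (#|[set c in jfaces n | t \subset c]| == 1%N)]].

Definition int_jfaces (j : nat) : {set {set D}} := jfaces j :\: boundary.

Definition face (j : nat) := {b : {set D} | b \in jfaces j}.
Definition int_face (j : nat) := {b : {set D} | b \in int_jfaces j}.
HB.instance Definition _ j := Finite.on (face j).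
HB.instance Definition _ j := Finite.on (int_face j).

Definition pure : Prop :=
  jfaces n != finset.set0 /\
  forall b, maxset [in faces D] b -> b \in jfaces n.

(* [path _ c p] and [last c p = c'] say that c :: p is a chain from c to c'. *)
Definition hereditary : Prop :=
  forall c c', c \in jfaces n -> c' \in jfaces n -> c :&: c' != finset.set0 ->
  exists p : seq {set D},
    [/\ path (fun x y => x :&: y \in int_jfaces n.-1) c p, last c p = c' &
        forall x, x \in c :: p -> (x \in jfaces n) && (c :&: c' \subset x)].

Definition lift1 (x : 'rV[R]_n) : 'rV[R]_n.+1 :=
  row_mx (1 : 'M[R]_1) x : 'rV[R]_(1 + n).

Definition hat (b : {set D}) : set 'rV[R]_n.+1 :=
  conv_hull ([set 0] `|` lift1 @` simplex b).

Definition cone : set 'rV[R]_n.+1 :=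
  [set 0] `|` \bigcup_(b in [set` faces D]) hat b.

End Complex.

Definition peval (R : realType) (m : nat) (p : mpoly m R) (x : 'rV[R]_m) : R :=
  meval (x ord0) p.

(* f is C^k on A: its partial derivatives of order at most k exist in the
   interior of A and extend continuously to A. *)
Fixpoint Ck_on (R : realType) (m k : nat) (A : set 'rV[R]_m.+1)
    (f : 'rV[R]_m.+1 -> R) : Prop :=
  {within A, continuous f} /\
  if k is k'.+1 then
    forall j : 'I_m.+1, exists2 g : 'rV[R]_m.+1 -> R, Ck_on k' A g &
      forall x, (interior A) x -> is_derive x (delta_mx ord0 j) f (g x)
  else True.

(* Real functions on R^{n+1}, as a module over the polynomial ring. *)
Definition real_fun (R : realType) (n : nat) := 'rV[R]_n.+1 -> R.
HB.instance Definition _ R n :=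
  GRing.Zmodule.copy (real_fun R n) ('rV[R]_n.+1 -> R).

Section RealFun.
Variables (R : realType) (n : nat).
Local Notation S := (mpoly n.+1 R).

Definition poly_act (p : S) (f : real_fun R n) : real_fun R n :=
  fun x => peval p x * f x.

Lemma poly_actA p q f : poly_act p (poly_act q f) = poly_act (p * q) f.
Proof. by apply/funext => x; rewrite /poly_act /peval mevalM mulrA. Qed.
Lemma poly_act1 : left_id 1 poly_act.
Proof. by move=> f; apply/funext => x; rewrite /poly_act /peval meval1 mul1r. Qed.
Lemma poly_actDr : right_distributive poly_act +%R.
Proof. by move=> p f g; apply/funext => x; exact: mulrDr. Qed.
Lemma poly_actDl f : {morph poly_act^~ f : p q / p + q}.
Proof.
by move=> p q; apply/funext => x; rewrite /poly_act /peval mevalD; exact: mulrDl.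
Qed.

HB.instance Definition _ := GRing.Zmodule_isLmodule.Build S (real_fun R n)
  poly_actA poly_act1 poly_actDr poly_actDl.

End RealFun.

Section Splines.
Variables (R : realType) (n i : nat) (D : simplicial_complex R n).
Variables (r : int_face D n.-1 -> nat) (s : face D i -> nat).
Local Notation S := (mpoly n.+1 R).

(* The union of the (n+1)-simplices of the cone that contain hat t. *)
Definition cone_star (t : {set D}) : set 'rV[R]_n.+1 :=
  \bigcup_(c in [set c | c \in jfaces D n /\ t \subset c]) hat c.

(* A function on the cone is represented by its extension by 0 to R^{n+1}. *)
Definition is_spline (f : real_fun R n) : Prop :=
  [/\ forall x, ~ cone D x -> f x = 0,
      {within cone D, continuous f},
      forall t : int_face D n.-1, Ck_on (r t) (cone_star (val t)) f
    & exists2 p : face D n -> S,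
        forall (c : face D n) x, hat (val c) x -> f x = peval (p c) x &
        forall (b : face D i) (c c' : face D n),
          val b \subset val c -> val b \subset val c' ->
          forall a : multinom n.+1, (mdeg a <= s b)%N ->
          forall x, hat (val b) x ->
            peval (mderivm a (p c)) x = peval (mderivm a (p c')) x].

Definition splines : {pred real_fun R n} := [pred f | `[< is_spline f >]].

End Splines.

Section Ideals.
Variable A : comNzRingType.

Definition ideal_span (G : set A) : set A :=
  [set p | exists k (a g : 'I_k -> A),
     (forall j, G (g j)) /\ p = \sum_(j < k) a j * g j].

Definition ideal_pow (I : set A) (m : nat) : set A :=
  ideal_span [set p | exists2 g : 'I_m -> A, forall j, I (g j) &
                                             p = \prod_(j < m) g j].

Lemma ideal_span0 (G : set A) : ideal_span G 0.
Proof.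
exists 0%N, (fun=> 0), (fun=> 0); split; first by case.
by rewrite big_ord0.
Qed.

Lemma ideal_spanD (G : set A) p q :
  ideal_span G p -> ideal_span G q -> ideal_span G (p + q).
Proof.
move=> [k [a [g [Gg ->]]]] [k' [a' [g' [Gg' ->]]]].
exists (k + k')%N,
  (fun j => match fintype.split j with inl u => a u | inr u => a' u end),
  (fun j => match fintype.split j with inl u => g u | inr u => g' u end).
split=> [j|]; first by case: (fintype.split j).
rewrite big_split_ord /=; congr (_ + _); apply: eq_bigr => j _.
  by rewrite (unsplitK (inl j : 'I_k + 'I_k')).
by rewrite (unsplitK (inr j : 'I_k + 'I_k')).
Qed.

Lemma ideal_spanM (G : set A) p q : ideal_span G q -> ideal_span G (p * q).
Proof.
move=> [k [a [g [Gg ->]]]]; exists k, (fun j => p * a j), g; split=> //.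
by rewrite mulr_sumr; apply: eq_bigr => j _; rewrite mulrA.
Qed.

End Ideals.

Section Homogenization.
Variables (R : realType) (n : nat).

(* x_0^(d - |a|) * x^a, where x_0 is the variable of index [ord0]. *)
Definition hmonomial (d : nat) (a : multinom n) : multinom n.+1 :=
  Multinom [tuple oapp a (d - mdeg a)%N (unlift ord0 j) | j < n.+1].

Definition homogenize (p : mpoly n R) : mpoly n.+1 R :=
  \sum_(a <- msupp p)
    mcoeff a p *: mpolyX R (hmonomial (mmeasure mdeg p).-1 a).

End Homogenization.

Section Boundary.
Variables (R : realType) (n i : nat) (D : simplicial_complex R n).
Variables (r : int_face D n.-1 -> nat) (s : face D i -> nat).
Local Notation S := (mpoly n.+1 R).
Variable l : int_face D n.-1 -> S.

Definition mhat (b : {set D}) : set S :=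
  ideal_span (@homogenize R n @`
    [set p : mpoly n R | forall x, simplex b x -> peval p x = 0]).

Definition J (t : int_face D n.-1) : {pred S} :=
  [pred p | `[< ideal_span [set l t ^+ (r t).+1] p /\
     forall b : face D i, val b \subset val t ->
       ideal_pow (mhat (val b)) (s b).+1 p >]].

(* The n-faces c are oriented by the orientation of R^n, the (n-1)-faces t by
   the enumeration of the vertices. If c = v |: t, then c is positively oriented
   as sg * [v, t_0, ..., t_(n-1)], so that [t_0, ..., t_(n-1)] has coefficient
   sg in the boundary of c. *)
Definition incidence (c t : {set D}) : R :=
  if t \subset c then
    Num.sg (\det (\matrix_(k < n.+1)
      nth 0 [seq lift1 (pos v) | v <- enum (c :\: t) ++ enum t] k))
  else 0.

(* The terms of the simplicial boundary that lie in the boundary of D are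
   dropped, as in relative chains. *)
Definition rel_boundary (f : {ffun face D n -> S^o}) (t : int_face D n.-1) : S :=
  \sum_(c : face D n) mpolyC n.+1 (incidence (val c) (val t)) * (f c : S).

End Boundary.

Section Closure.
Variables (R : realType) (n : nat).
Local Notation S := (mpoly n.+1 R).
Implicit Types (p q : S) (x : 'rV[R]_n.+1) (f : 'rV[R]_n.+1 -> R).

Lemma pevalD p q : peval (p + q) = (fun x => peval p x + peval q x).
Proof. by apply/funext => x; rewrite /peval mevalD. Qed.

Lemma pevalM p q : peval (p * q) = (fun x => peval p x * peval q x).
Proof. by apply/funext => x; rewrite /peval mevalM. Qed.

Lemma peval_ind (P : S -> Prop) :
  (forall c, P (mpolyC n.+1 c)) -> (forall j, P (mpolyX R (mnm1 j))) ->
  (forall p q, P p -> P q -> P (p + q)) ->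
  (forall p q, P p -> P q -> P (p * q)) -> forall p, P p.
Proof.
move=> PC PX PD PM p; have P0 : P 0 by have := PC 0; rewrite mpolyC0.
have P1 : P 1 by exact: PC.
elim/mpolyind: p => // c a p _ _ Pp; apply: PD => //; rewrite -mul_mpolyC.
apply: (PM) => //; rewrite mpolyXE_id; apply: (big_ind P P1 PM) => j _.
by elim: (a j) => [|k ih]; rewrite ?expr0 // exprS; apply: (PM).
Qed.

Lemma coord_is_derive (j k : 'I_n.+1) x :
  is_derive x (delta_mx ord0 k) (fun y : 'rV[R]_n.+1 => y ord0 j) (j == k)%:R.
Proof.
have cvg_q : (fun h : R => h^-1 *: (((fun y : 'rV[R]_n.+1 => y ord0 j) \o shift x)
    (h *: delta_mx ord0 k) - x ord0 j)) @ 0^' --> ((j == k)%:R : R^o).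
  apply: cvg_near_cst; near=> h.
  rewrite /= !mxE eqxx /= addrK /GRing.scale /= mulrA mulVf ?mul1r //.
  by near: h; exact: nbhs_dnbhs_neq.
by apply: DeriveDef; [exact: cvgP cvg_q | exact/cvg_lim].
Unshelve. all: by end_near. Qed.

Lemma peval_is_derive p (k : 'I_n.+1) x :
  is_derive x (delta_mx ord0 k) (peval p) (peval (mderiv k p) x).
Proof.
elim/peval_ind: p => [c|j|p q ihp ihq|p q ihp ihq].
- rewrite mderivC /peval meval0 (_ : (fun _ => _) = cst c); last first.
    by apply/funext => y; rewrite mevalC.
  exact: is_derive_cst.
- rewrite mderivX /peval mevalZ mnm1E.
  rewrite (_ : (fun y => _) = (fun y : 'rV[R]_n.+1 => y ord0 j)); last first.
    by apply/funext => y; rewrite mevalXU.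
  apply: is_derive_eq; first exact: coord_is_derive.
  have [->|_] := eqVneq j k; last by rewrite mul0r.
  suff -> : mnm_sub (mnm1 k) (mnm1 k) = mnm0 by rewrite mpolyX0 meval1 mulr1.
  by apply/mnmP => h; rewrite mnmBE subnn mnm0E.
- by rewrite mderivD !pevalD; exact: is_deriveD.
rewrite mderivM pevalD !pevalM.
apply: is_derive_eq (is_deriveM ihp ihq) _.
by rewrite addrC [in RHS]mulrC.
Qed.

Lemma peval_continuous p : continuous (peval p).
Proof.
elim/peval_ind: p => [c|j|p q ihp ihq|p q ihp ihq] x.
- have -> : peval (mpolyC n.+1 c) = cst c.
    by apply/funext => y; rewrite /peval mevalC.
  exact: cst_continuous.
- have -> : peval (mpolyX R (mnm1 j)) = (fun y : 'rV[R]_n.+1 => y ord0 j).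
    by apply/funext => y; rewrite /peval mevalXU.
  exact: coord_continuous.
- by rewrite pevalD; exact: (cvgD (ihp x) (ihq x)).
by rewrite pevalM; exact: (cvgM (ihp x) (ihq x)).
Qed.

Lemma within_continuous0 (A : set 'rV[R]_n.+1) :
  {within A, continuous (fun=> 0 : R)}.
Proof. by move=> x; exact: cvg_cst. Qed.

Lemma within_continuousD (A : set 'rV[R]_n.+1) f g :
  {within A, continuous f} -> {within A, continuous g} ->
  {within A, continuous (fun x => f x + g x)}.
Proof. by move=> cf cg x; apply: cvgD; [exact: cf|exact: cg]. Qed.

Lemma within_continuousM (A : set 'rV[R]_n.+1) p f :
  {within A, continuous f} -> {within A, continuous (fun x => peval p x * f x)}.
Proof.
move=> cf x; apply: cvgM; last exact: cf.
by apply: (continuous_subspaceT (f := peval p)); exact: peval_continuous.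
Qed.

Lemma Ck_on0 k (A : set 'rV[R]_n.+1) : Ck_on k A (fun=> 0).
Proof.
elim: k => [|k ih] /=; first by split=> //; exact: within_continuous0.
split; first exact: within_continuous0.
by move=> j; exists (fun=> 0) => // x _; exact: is_derive_cst.
Qed.

Lemma Ck_onD k (A : set 'rV[R]_n.+1) f g :
  Ck_on k A f -> Ck_on k A g -> Ck_on k A (fun x => f x + g x).
Proof.
elim: k f g => [|k ih] f g /= [cf df] [cg dg].
  by split=> //; exact: within_continuousD.
split=> [|j]; first exact: within_continuousD.
have [f' Cf' f'P] := df j; have [g' Cg' g'P] := dg j.
exists (fun x => f' x + g' x); first exact: ih.
by move=> x Ax; apply: is_deriveD; [exact: f'P|exact: g'P].
Qed.

Lemma Ck_onW k (A : set 'rV[R]_n.+1) f : Ck_on k.+1 A f -> Ck_on k A f.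
Proof.
elim: k f => [|k ih] f [cf df]; first by split.
split=> // j; have [g Cg gP] := df j.
by exists g => //; exact: ih.
Qed.

Lemma Ck_onM k (A : set 'rV[R]_n.+1) p f :
  Ck_on k A f -> Ck_on k A (fun x => peval p x * f x).
Proof.
elim: k p f => [|k ih] p f Cf.
  by case: Cf => cf _; split=> //; exact: within_continuousM.
case: (Cf) => cf df; split=> [|j]; first exact: within_continuousM.
have [g Cg gP] := df j.
exists (fun x => peval p x * g x + peval (mderiv j p) x * f x).
  by apply: Ck_onD; apply: ih => //; exact: Ck_onW.
move=> x Ax; have := gP x Ax => fx; have px := peval_is_derive p j x.
apply: is_derive_eq (is_deriveM px fx) _.
by rewrite [X in _ = _ + X]mulrC.
Qed.

Lemma mderivm_vanishM d p q x :
  (forall a : multinom n.+1, (mdeg a <= d)%N -> peval (mderivm a q) x = 0) ->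
  forall a : multinom n.+1, (mdeg a <= d)%N -> peval (mderivm a (p * q)) x = 0.
Proof.
elim: d p q => [|d ih] p q q0 a a_le.
  have a0 : a = mnm0 by apply/eqP; rewrite -mdeg_eq0 -leqn0.
  by have := q0 mnm0; rewrite a0 !mderivm0m mdeg0 /peval mevalM => ->; rewrite ?mulr0.
have [a_le'|a_gt] := leqP (mdeg a) d.
  by apply: (ih p q) => // b b_le; apply: q0; exact: leqW.
have [j aj] : exists j, (0 < a j)%N.
  apply/existsP; apply: contraLR a_gt; rewrite negb_exists => /forallP a0.
  rewrite -leqNgt mdegE big1 // => j _.
  by apply/eqP; rewrite -leqn0 leqNgt; exact: a0.
have aE : mnm_add (mnm1 j) (mnm_sub a (mnm1 j)) = a.
  rewrite addmC; apply: submK; apply/mnm_lepP => k; rewrite mnm1E.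
  by case: eqP => [<-|].
have b_le : (mdeg (mnm_sub a (mnm1 j)) <= d)%N.
  by move: a_le; rewrite -{1}aE mdegD mdeg1.
rewrite -aE mderivmDm mderivmU1m mderivM mderivmD pevalD /=.
rewrite (ih (mderiv j p) q _ _ b_le) ?(ih p (mderiv j q) _ _ b_le) ?addr0 //.
- by move=> b b_le'; rewrite -mderivmU1m -mderivmDm; apply: q0; rewrite mdegD mdeg1.
- by move=> b b_le'; apply: q0; exact: leqW.
Qed.

Section SplineModule.
Variables (i : nat) (D : simplicial_complex R n).
Variables (r : int_face D n.-1 -> nat) (s : face D i -> nat).

Lemma real_funDE (f g : real_fun R n) x : (f + g) x = f x + g x.
Proof. by []. Qed.

Lemma real_funZE p (f : real_fun R n) x : (p *: f) x = peval p x * f x.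
Proof. by []. Qed.

Lemma splines_closed : subsemimod_closed (splines r s).
Proof.
split; first split.
- apply/asboolP; split=> //; first exact: within_continuous0.
    by move=> t; exact: Ck_on0.
  by exists (fun=> 0) => // c x _; rewrite /peval meval0.
- move=> f g /asboolP[f0 cf Cf [p pP ps]] /asboolP[g0 cg Cg [q qP qs]].
  apply/asboolP; split.
  + by move=> x Dx; rewrite real_funDE f0 // g0 // addr0.
  + exact: (@within_continuousD _ f g).
  + by move=> t; exact: (@Ck_onD _ _ f g).
  + exists (fun c => p c + q c).
      move=> c x cx; rewrite real_funDE (pP c) // (qP c) //.
      by rewrite pevalD.
    move=> b c c' bc bc' a ale x bx; rewrite !mderivmD !pevalD.
    by rewrite (ps b c c') // (qs b c c').
- move=> p f /asboolP[f0 cf Cf [q qP qs]]; apply/asboolP; split.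
  + by move=> x Dx; rewrite real_funZE f0 // mulr0.
  + exact: (@within_continuousM _ p f).
  + by move=> t; exact: (@Ck_onM _ _ p f).
  + exists (fun c => p * q c).
      by move=> c x cx; rewrite real_funZE (qP c) // pevalM.
    move=> b c c' bc bc' a ale x bx; apply/eqP; rewrite -subr_eq0 /peval.
    rewrite -mevalB -mderivmB -mulrBr; apply/eqP.
    apply: (@mderivm_vanishM (s b)) => // a' a'le.
    rewrite mderivmB /peval mevalB; apply/eqP; rewrite subr_eq0; apply/eqP.
    exact: (qs b c c').
Qed.

HB.instance Definition _ :=
  GRing.isSubmodClosed.Build S (real_fun R n) (splines r s) splines_closed.

Record spline_space := SplineSpace {
  spline_fun : real_fun R n; _ : spline_fun \in splines r s }.
HB.instance Definition _ := [isSub for spline_fun].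
HB.instance Definition _ := [Choice of spline_space by <:].
HB.instance Definition _ := [SubChoice_isSubLmodule of spline_space by <:].

End SplineModule.

Section Kernel.
Variables (i : nat) (D : simplicial_complex R n).
Variables (r : int_face D n.-1 -> nat) (s : face D i -> nat).
Variable l : int_face D n.-1 -> S.

Lemma J_mulr t p q : q \in J r s l t -> p * q \in J r s l t.
Proof.
move=> /asboolP[lq mq]; apply/asboolP; split; first exact: ideal_spanM.
by move=> b bt; apply: ideal_spanM; exact: mq.
Qed.

Lemma J_zmod_closed t : zmod_closed (J r s l t).
Proof.
split; first by apply/asboolP; split=> *; exact: ideal_span0.
move=> p q Jp /(J_mulr (-1)); rewrite mulN1r => Jq.
move/asboolP: Jp => [lp mp]; move/asboolP: Jq => [lq mq].
apply/asboolP; split; first exact: ideal_spanD.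
by move=> b bt; apply: ideal_spanD; [exact: mp|exact: mq].
Qed.

HB.instance Definition _ t :=
  GRing.isZmodClosed.Build S (J r s l t) (J_zmod_closed t).

Definition bdry (f : {ffun face D n -> S^o}) (t : int_face D n.-1) :
    Quotient.quot (J r s l t) :=
  \pi_(Quotient.quot (J r s l t))%qT (rel_boundary f t).

Definition bdry_ker : {pred {ffun face D n -> S^o}} :=
  [pred f | [forall t, bdry f t == 0]].

Lemma bdry_kerP (f : {ffun face D n -> S^o}) :
  reflect (forall t, rel_boundary f t \in J r s l t) (f \in bdry_ker).
Proof.
have E t : (bdry f t == 0) = (rel_boundary f t \in J r s l t).
  rewrite -[X in X \in _]subr0 Quotient.idealrBE.
  by rewrite /bdry !piE.
by apply: (iffP forallP) => H t; have := H t; rewrite E.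
Qed.

Lemma bdry_ker_closed : subsemimod_closed bdry_ker.
Proof.
split; first split.
- apply/bdry_kerP => t; rewrite /rel_boundary big1 ?rpred0 // => c _.
  by rewrite ffunE mulr0.
- move=> f g /bdry_kerP f0 /bdry_kerP g0; apply/bdry_kerP => t.
  have -> : rel_boundary (f + g) t = rel_boundary f t + rel_boundary g t.
    by rewrite -big_split; apply: eq_bigr => c _; rewrite ffunE mulrDr.
  exact: rpredD.
- move=> p f /bdry_kerP f0; apply/bdry_kerP => t.
  have -> : rel_boundary (p *: f) t = p * rel_boundary f t.
    by rewrite mulr_sumr; apply: eq_bigr => c _; rewrite ffunE mulrCA.
  exact: J_mulr.
Qed.

HB.instance Definition _ :=
  GRing.isSubmodClosed.Build S {ffun face D n -> S^o} bdry_ker bdry_ker_closed.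

Record bdry_kernel := BdryKernel {
  bdry_kernel_val : {ffun face D n -> S^o}; _ : bdry_kernel_val \in bdry_ker }.
HB.instance Definition _ := [isSub for bdry_kernel_val].
HB.instance Definition _ := [Choice of bdry_kernel by <:].
HB.instance Definition _ := [SubChoice_isSubLmodule of bdry_kernel by <:].

End Kernel.
End Closure.

(* Main.v *)
Require Import Defs.
From HB Require Import structures.
From mathcomp Require Import all_boot all_order all_algebra.
From mathcomp Require Import all_classical all_reals all_analysis.
From mathcomp Require Import -(notations) mpoly.
Import Order.TTheory GRing.Theory Num.Theory.
Import numFieldNormedType.Exports.
Local Open Scope classical_set_scope.
Local Open Scope ring_scope.

(* A spline [f] restricts to one polynomial [P c] on the cone over each [n]-face
   [c], and an [n]-dimensional cone is Zariski dense, so [f |-> P] is linear and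
   injective. Membership of [P c - P c'] in [J t], where [t] is the common facet
   of [c] and [c'], is a condition on orders of vanishing: by Taylor expansion
   around a linear projection onto the span of the cone over [b],
   the [d]-th power of the ideal of that cone consists of the polynomials whose
   derivatives of order less than [d] vanish on it; for a facet this ideal is
   generated by [l t]. Since [incidence c t] and [incidence c' t] are opposite,
   the kernel is the set of the families [P] that satisfy these conditions at all
   interior facets. For a spline they express smoothness across [t] and
   supersmoothness at [b]; conversely they propagate along the chains given by
   [hereditary], and along the connected polyhedron for the value at the origin,
   so that the family glues to a spline. *)

Set Implicit Arguments.
Unset Strict Implicit.
Unset Printing Implicit Defensive.

(** * Ideals, Taylor expansion and zeros of polynomials *)

Section IdealSpan.
Variable A : comNzRingType.
Implicit Types G : set A.

Lemma sub_ideal_span G (g : A) : G g -> ideal_span G g.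
Proof.
move=> Gg; exists 1%N, (fun=> 1), (fun=> g); split=> //.
by rewrite big_ord1 mul1r.
Qed.

Lemma ideal_span_sum G (I : Type) (r : seq I) (P : pred I) (F : I -> A) :
  (forall j, P j -> ideal_span G (F j)) -> ideal_span G (\sum_(j <- r | P j) F j).
Proof.
move=> GF; apply: (big_ind (ideal_span G)) => //; first exact: ideal_span0.
by move=> p q; exact: ideal_spanD.
Qed.

(** Elimination rule for spans: [Q] has to absorb scalars on generators only, so it need not be
    known to be an ideal. *)
Lemma ideal_span_min G (Q : A -> Prop) :
  Q 0 -> (forall p q, Q p -> Q q -> Q (p + q)) ->
  (forall a g, G g -> Q (a * g)) -> forall p, ideal_span G p -> Q p.
Proof.
move=> Q0 QD QM p [k [a [g [Gg ->]]]].
by apply: (big_ind Q) => // j _; exact: QM.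
Qed.

End IdealSpan.

(** Splitting off one variable is the step of the inductions on the order of a derivative or the
    degree of a monomial. *)
Lemma mnm_recl k (a : multinom k) : (0 < mdeg a)%N ->
  exists j (b : multinom k), a = mnm_add (mnm1 j) b /\ mdeg a = (mdeg b).+1.
Proof.
move=> a_gt0; have [j aj] : exists j, (0 < a j)%N.
  apply/existsP; apply: contraLR a_gt0; rewrite negb_exists => /forallP a0.
  rewrite -leqNgt mdegE big1 // => j _.
  by apply/eqP; rewrite -leqn0 leqNgt; exact: a0.
exists j, (mnm_sub a (mnm1 j)).
have aE : a = mnm_add (mnm1 j) (mnm_sub a (mnm1 j)).
  rewrite addmC; apply/esym/submK; apply/mnm_lepP => i; rewrite mnm1E.
  by case: eqP => [<-|].
by split=> //; rewrite [in LHS]aE mdegD mdeg1.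
Qed.

Section IdealPow.
Variables (A : comNzRingType) (G : set A).

Lemma ideal_pow0 p : ideal_pow G 0 p.
Proof.
rewrite -[p]mulr1; apply: ideal_spanM; apply: sub_ideal_span.
by exists (fun=> 1); [case | rewrite big_ord0].
Qed.

Lemma ideal_powS m g p : G g -> ideal_pow G m p -> ideal_pow G m.+1 (g * p).
Proof.
move=> Gg; move: p; apply: (ideal_span_min (Q := fun p => ideal_pow G m.+1 (g * p))).
- by rewrite mulr0; exact: ideal_span0.
- by move=> p q gp gq; rewrite mulrDr; exact: ideal_spanD.
move=> a _ [h Gh ->]; rewrite mulrCA; apply: ideal_spanM; apply: sub_ideal_span.
exists (fun j => if unlift ord0 j is Some j' then h j' else g).
  by move=> j; case: unliftP => // j' _; exact: Gh.
rewrite big_ord_recl unlift_none; congr (_ * _).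
by apply: eq_bigr => j _; rewrite liftK.
Qed.

Lemma ideal_powX m g : G g -> ideal_pow G m (g ^+ m).
Proof.
move=> Gg; elim: m => [|m ih]; first exact: ideal_pow0.
by rewrite exprS; exact: ideal_powS.
Qed.

(** Peeling off [m] factors one by one suffices; the rest is absorbed, the zeroth power being the
    whole ring. *)
Lemma ideal_pow_mon k (h : 'I_k -> A) m (a : multinom k) :
  (forall j, G (h j)) -> (m <= mdeg a)%N ->
  ideal_pow G m (\prod_(j < k) h j ^+ a j).
Proof.
move=> Gh; elim: m a => [|m ih] a a_ge; first exact: ideal_pow0.
have [j [b [aE ab]]] := mnm_recl (leq_ltn_trans (leq0n m) a_ge).
have -> : \prod_(j < k) h j ^+ a j = h j * \prod_(j < k) h j ^+ b j.
  rewrite aE (bigD1 j) //= [in RHS](bigD1 j) //= mulrA -exprS.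
  rewrite mnmDE mnm1E eqxx; congr (_ * _); apply: eq_bigr => i ij.
  by rewrite mnmDE mnm1E eq_sym (negPf ij).
by apply: ideal_powS => //; apply: ih; rewrite -ltnS -ab.
Qed.

End IdealPow.

Section Taylor.
Variables (R : realType) (n : nat).
Local Notation S := (mpoly n.+1 R).
Implicit Types (p q : S).

Variable h : 'I_n.+1 -> S.

(** This is [q(h + Y)] with coefficients in [S], where [Y] are the outer variables; its coefficient
    at [Y^a] is the [a]-th derivative of [q] at [h], divided by [a!]. *)
Definition taylor : S -> mpoly n.+1 S :=
  mmap (@mpolyC n.+1 S \o @mpolyC n.+1 R) (fun j => mpolyC n.+1 (h j) + mpolyX S (mnm1 j)).

Definition subst : S -> S := mmap (@mpolyC n.+1 R) h.

Lemma taylorD : {morph taylor : p q / p + q}.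
Proof. exact: rmorphD. Qed.

Lemma taylorM : {morph taylor : p q / p * q}.
Proof. exact: rmorphM. Qed.

Lemma substD : {morph subst : p q / p + q}.
Proof. exact: rmorphD. Qed.

Lemma substM : {morph subst : p q / p * q}.
Proof. exact: rmorphM. Qed.

Lemma mderiv_taylor j q : mderiv j (taylor q) = taylor (mderiv j q).
Proof.
elim/peval_ind: q => [c|k|p q ihp ihq|p q ihp ihq].
- by rewrite /taylor mmapC mderivC mderivC mmap0.
- rewrite /taylor mmapX mmap1U mderivD mderivC add0r !mderivX mnm1E.
  have [->|_] := eqVneq k j; last by rewrite !scale0r mmap0.
  have -> : mnm_sub (mnm1 j) (mnm1 j) = mnm0.
    by apply/mnmP => i; rewrite mnmBE subnn mnm0E.
  by rewrite !scale1r !mpolyX0 rmorph1.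
- rewrite (mderivD j p q).
  rewrite (taylorD p q).
  rewrite (taylorD (mderiv j p)).
  rewrite -ihp -ihq.
  exact: mderivD.
rewrite (mderivM j p q) (taylorM p q) (taylorD (mderiv j p * q)).
rewrite (taylorM (mderiv j p)) (taylorM p) -ihp -ihq.
by rewrite (mderivM j (taylor p)).
Qed.

Lemma mderivm_taylor a q : mderivm a (taylor q) = taylor (mderivm a q).
Proof.
have [d] := ubnP (mdeg a); elim: d a q => // d ih a q ad.
have [a0|a_gt0] := posnP (mdeg a).
  by move/eqP: a0; rewrite mdeg_eq0 => /eqP ->; rewrite !mderivm0m.
have [j [b [aE ab]]] := mnm_recl a_gt0; rewrite aE.
have bd : (mdeg b < d)%N by move: ad; rewrite ab ltnS.
by rewrite !mderivmDm !mderivmU1m mderiv_taylor ih.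
Qed.

Lemma mcoeff0_taylor q : mcoeff mnm0 (taylor q) = subst q.
Proof.
elim/peval_ind: q => [c|k|p q ihp ihq|p q ihp ihq].
- by rewrite /taylor /subst !mmapC /= mcoeffC eqxx mulr1.
- rewrite /taylor /subst !mmapX !mmap1U mcoeffD mcoeffC eqxx mulr1 mcoeffX.
  case: eqP => [/mnmP/(_ k)|_]; last by rewrite addr0.
  by rewrite mnm1E eqxx mnm0E.
- by rewrite (taylorD p) (substD p) -ihp -ihq; exact: mcoeffD.
by rewrite (taylorM p) (substM p) -ihp -ihq; exact: rmorphM.
Qed.

(** Putting [Y = X - h] in [q(h + Y)] gives [q] back. *)
Lemma meval_taylor q : meval (fun j => mpolyX R (mnm1 j) - h j) (taylor q) = q.
Proof.
elim/peval_ind: q => [c|k|p q ihp ihq|p q ihp ihq].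
- by rewrite /taylor mmapC mevalC.
- by rewrite /taylor mmapX mmap1U mevalD mevalC mevalXU addrC subrK.
- by rewrite (taylorD p) -[RHS](congr2 +%R ihp ihq); exact: mevalD.
by rewrite (taylorM p) -[RHS](congr2 *%R ihp ihq); exact: mevalM.
Qed.

(** The constant term of the [a]-th derivative of [taylor q] is [a!] times the [a]-th coefficient of
    [taylor q]; here [N] is [a!], which is nonzero in [R]. *)
Lemma taylor_coeff_eq0 a q : subst (mderivm a q) = 0 -> mcoeff a (taylor q) = 0.
Proof.
rewrite -mcoeff0_taylor -mderivm_taylor mcoeff_mderivm addm0.
set N := (\prod_(j < n.+1) _)%N; have N_gt0 : (0 < N)%N.
  by apply: prodn_gt0 => j; rewrite ffactnn fact_gt0.
move=> c0; apply/eqP; have : (N%:R : R) *: mcoeff a (taylor q) == 0.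
  by rewrite scaler_nat c0.
by rewrite scaler_eq0 pnatr_eq0 eqn0Ngt N_gt0.
Qed.

(* Taylor expansion of [q] at the point [h]: only the terms in [X - h] of
   degree at least [d] survive. *)
Lemma taylor_ideal_pow (G : set S) d q :
  (forall a, (mdeg a < d)%N -> subst (mderivm a q) = 0) ->
  (forall j, G (mpolyX R (mnm1 j) - h j)) -> ideal_pow G d q.
Proof.
move=> q0 Gh; rewrite -[q]meval_taylor mevalE; apply: ideal_span_sum => a _.
have [a_ge|a_lt] := leqP d (mdeg a).
  by apply: ideal_spanM; exact: ideal_pow_mon.
by rewrite (taylor_coeff_eq0 (q0 a a_lt)) mul0r; exact: ideal_span0.
Qed.

Lemma peval_subst q x : peval (subst q) x = peval q (\row_j peval (h j) x).
Proof.
elim/peval_ind: q => [c|k|p q ihp ihq|p q ihp ihq].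
- by rewrite /subst mmapC /peval !mevalC.
- by rewrite /subst mmapX mmap1U /peval !mevalXU mxE.
- by rewrite (substD p) (pevalD p) (pevalD (subst p)) ihp ihq.
by rewrite (substM p) (pevalM p) (pevalM (subst p)) ihp ihq.
Qed.

End Taylor.

(** * Zeros of polynomial functions and order of vanishing at a point *)

Section Peval.
Variables (R : realType) (n : nat).
Local Notation S := (mpoly n.+1 R).
Implicit Types (p q : S) (x y : 'rV[R]_n.+1).

Lemma pevalB p q x : peval (p - q) x = peval p x - peval q x.
Proof. exact: mevalB. Qed.

Lemma mcoeff0_peval q : mcoeff mnm0 q = peval q 0.
Proof.
elim/peval_ind: q => [c|k|p q ihp ihq|p q ihp ihq].
- by rewrite mcoeffC eqxx mulr1 /peval mevalC.
- rewrite mcoeffX /peval mevalXU mxE; case: eqP => // /mnmP/(_ k).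
  by rewrite mnm1E eqxx mnm0E.
- by rewrite mcoeffD ihp ihq pevalD.
by rewrite rmorphM /= ihp ihq pevalM.
Qed.

(** All derivatives of such a [q] vanish as functions, and their values at the origin are the
    coefficients of [q] times factorials. *)
Lemma peval_eq0 q : (forall x, peval q x = 0) -> q = 0.
Proof.
move=> q0; have Dq0 a x : peval (mderivm a q) x = 0.
  have [d] := ubnP (mdeg a); elim: d a q q0 x => // d ih a q q0 x ad.
  have [a0|a_gt0] := posnP (mdeg a).
    by move/eqP: a0; rewrite mdeg_eq0 => /eqP ->; rewrite mderivm0m.
  have [j [b [aE ab]]] := mnm_recl a_gt0; rewrite aE.
  have bd : (mdeg b < d)%N by move: ad; rewrite ab ltnS.
  rewrite mderivmDm mderivmU1m ih // => y.
  rewrite -(@derive_val _ _ _ _ _ _ _ (peval_is_derive q j y)).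
  by rewrite (_ : peval q = cst 0) ?derive_cst //; apply/funext.
apply/mpolyP => a; rewrite mcoeff0; have := Dq0 a 0.
rewrite -mcoeff0_peval mcoeff_mderivm addm0 => /eqP.
rewrite mulrn_eq0 => /orP[|/eqP //]; rewrite eqn0Ngt prodn_gt0 // => j.
by rewrite ffactnn fact_gt0.
Qed.

Lemma poly_eq0_unit_interval (p : {poly R}) :
  (forall t : R, 0 <= t <= 1 -> p.[t] = 0) -> p = 0.
Proof.
move=> p0; apply/eqP/negP => /negP/max_poly_roots.
(* These are [size p] distinct roots in the interval, one more than a nonzero [p] can have. *)
move=> /(_ [seq (k.+1%:R : R)^-1 | k <- iota 0 (size p)]).
rewrite size_map size_iota ltnn => H; suff : false by [].
apply: H.
  apply/allP => _ /mapP[k _ ->]; apply/rootP/p0.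
  by rewrite invr_ge0 ler0n invf_le1 ?ler1n ?ltr0n.
by rewrite map_inj_uniq ?iota_uniq // => j k /invr_inj /eqP; rewrite eqr_nat => /eqP [].
Qed.

Lemma peval_line q x y :
  (forall t : R, 0 <= t <= 1 -> peval q (x + t *: y) = 0) ->
  forall t, peval q (x + t *: y) = 0.
Proof.
(* [f p] is the univariate restriction of [p] to the line through [x] with direction [y]. *)
pose f := mmap (@polyC R) (fun j => (x ord0 j)%:P + y ord0 j *: 'X).
have fE p t : (f p).[t] = peval p (x + t *: y).
  elim/peval_ind: p => [c|k|p p' ihp ihq|p p' ihp ihq].
  - by rewrite /f mmapC hornerC /peval mevalC.
  - by rewrite /f mmapX mmap1U /peval mevalXU !hornerE !mxE mulrC.
  - by rewrite (_ : f (p + p') = f p + f p') ?hornerD ?pevalD ?ihp ?ihq //; exact: rmorphD.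
  by rewrite (_ : f (p * p') = f p * f p') ?hornerM ?pevalM ?ihp ?ihq //; exact: rmorphM.
move=> q0 t; rewrite -fE (_ : f q = 0) ?horner0 //.
by apply: poly_eq0_unit_interval => u u01; rewrite fE q0.
Qed.

(** The convex hull of the origin and the [u v] is Zariski dense in their span: the line from the
    point with small equal weights [c] to the given point starts with a segment inside the hull. *)
Lemma peval_span (I : finType) (b : {set I}) (u : I -> 'rV[R]_n.+1) q :
  (forall w : I -> R, (forall v, 0 <= w v) -> \sum_(v in b) w v <= 1 ->
     peval q (\sum_(v in b) w v *: u v) = 0) ->
  forall w : I -> R, peval q (\sum_(v in b) w v *: u v) = 0.
Proof.
(* With this [c], weights between [0] and [2c] sum to at most [1]. *)
move=> q0 w; pose c : R := (#|b|.+1 * 2)%:R^-1.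
have c_gt0 : 0 < c by rewrite invr_gt0 ltr0n.
pose M := 1 + \sum_(v in b) `|w v - c|.
have M_gt0 : 0 < M by rewrite ltr_pwDl // sumr_ge0.
(* The factor [d] keeps each weight at distance at most [c] from [c] while [t] runs from [0] to [1];
   the given point is reached at [t = d^-1]. *)
pose d := c / M; have d_gt0 : 0 < d by rewrite divr_gt0.
pose x := \sum_(v in b) c *: u v; pose y := \sum_(v in b) (d * (w v - c)) *: u v.
have xyE t : x + t *: y = \sum_(v in b) (c + t * (d * (w v - c))) *: u v.
  rewrite scaler_sumr -big_split /=; apply: eq_bigr => v _.
  by rewrite scalerDl scalerA.
have -> : \sum_(v in b) w v *: u v = x + d^-1 *: y.
  rewrite xyE; apply: eq_bigr => v _; congr (_ *: _).
  by rewrite mulrA mulVf ?gt_eqF // mul1r addrC subrK.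
apply: peval_line => t /andP[t0 t1]; rewrite xyE.
have bnd v : v \in b -> `|t * (d * (w v - c))| <= c.
  move=> vb; rewrite normrM (ger0_norm t0) normrM (gtr0_norm d_gt0).
  apply: le_trans (_ : d * M <= c); last by rewrite divfK ?gt_eqF.
  rewrite -[leRHS]mul1r; apply: ler_pM => //; first by rewrite mulr_ge0 // ltW.
  rewrite (ler_pM2l d_gt0).
  by rewrite /M (bigD1 v) //= addrCA lerDl addr_ge0 // sumr_ge0.
(* The hypothesis asks for nonnegative weights off [b] as well, hence the value [0] there. *)
pose w' v := if v \in b then c + t * (d * (w v - c)) else 0.
rewrite (eq_bigr (fun v => w' v *: u v)); last by move=> v vb; rewrite /w' vb.
apply: q0 => [v|].
  rewrite /w'; case: ifPn => // vb.
  by have := bnd v vb; rewrite ler_norml -subr_ge0 opprK addrC => /andP[].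
apply: le_trans (_ : \sum_(v in b) (c *+ 2) <= 1).
  apply: ler_sum => v vb; rewrite /w' vb mulr2n lerD2l.
  by have := bnd v vb; rewrite ler_norml => /andP[].
rewrite sumr_const -mulrnA -mulr_natr mulrC ler_pdivrMr ?ltr0n // mul1r ler_nat.
by rewrite mulnC leq_pmul2r.
Qed.

(** The bound is strict, so that [d] is an order of vanishing: two polynomials share their
    derivatives up to order [k] at [x] when their difference vanishes to order [k.+1]. *)
Definition vanishes d x q :=
  forall a : multinom n.+1, (mdeg a < d)%N -> peval (mderivm a q) x = 0.

Lemma vanishes_deriv d x q : peval q x = 0 ->
  (forall j, vanishes d x (mderiv j q)) -> vanishes d.+1 x q.
Proof.
move=> q0 Dq a ad; have [a0|a_gt0] := posnP (mdeg a).
  by move/eqP: a0; rewrite mdeg_eq0 => /eqP ->; rewrite mderivm0m.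
have [j [b [aE ab]]] := mnm_recl a_gt0; rewrite aE.
have bd : (mdeg b < d)%N by move: ad; rewrite ab ltnS.
by rewrite mderivmDm mderivmU1m Dq.
Qed.

Lemma vanishes_mderiv d x q j : vanishes d.+1 x q -> vanishes d x (mderiv j q).
Proof.
by move=> q0 a ad; rewrite -mderivmU1m -mderivmDm q0 // mdegD mdeg1 add1n ltnS.
Qed.

Lemma vanishesMl d x p q : vanishes d x q -> vanishes d x (p * q).
Proof.
case: d => [//|d] q0 a ad; by apply: (@mderivm_vanishM _ _ d).
Qed.

Lemma vanishesD d x p q : vanishes d x p -> vanishes d x q -> vanishes d x (p + q).
Proof. by move=> p0 q0 a ad; rewrite mderivmD pevalD p0 ?q0 ?addr0. Qed.

(** Induction on [d] by the product rule: one term still contains [q], the other is [g] times a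
    derivative of [q], which has lost one order. *)
Lemma vanishes_mulS d x g q :
  peval g x = 0 -> vanishes d x q -> vanishes d.+1 x (g * q).
Proof.
move=> g0; elim: d q => [|d ih] q q0.
  by apply: vanishes_deriv => //; rewrite pevalM g0 mul0r.
apply: vanishes_deriv => [|j]; first by rewrite pevalM g0 mul0r.
rewrite mderivM; apply: vanishesD; first exact: vanishesMl.
by apply: ih; exact: vanishes_mderiv.
Qed.

Lemma ideal_pow_vanishes (G : set S) d x q :
  (forall g, G g -> peval g x = 0) -> ideal_pow G d q -> vanishes d x q.
Proof.
move=> G0; move: q; apply: (ideal_span_min (Q := vanishes d x)).
- by move=> a _; rewrite raddf0 /peval meval0.
- by move=> p q; exact: vanishesD.
move=> a _ [g Gg ->]; apply: vanishesMl.
elim: d g Gg => [//|d ih] g Gg; rewrite big_ord_recl.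
by apply: vanishes_mulS; [exact: G0 | exact: ih].
Qed.

End Peval.

(** * Cones over simplices *)

Section Lift.
Variables (R : realType) (n : nat).
Implicit Types x y : 'rV[R]_n.

Lemma lift1_ord0 x : lift1 x ord0 ord0 = 1.
Proof.
have -> : lift1 x ord0 ord0 = row_mx 1 x ord0 (lshift n (ord0 : 'I_1)).
  by congr (row_mx _ _ _ _); exact: val_inj.
by rewrite row_mxEl mxE eqxx.
Qed.

Lemma lift1_lift x (j : 'I_n) : lift1 x ord0 (fintype.lift ord0 j) = x ord0 j.
Proof.
have -> : lift1 x ord0 (fintype.lift ord0 j) = row_mx 1 x ord0 (rshift 1 j).
  by congr (row_mx _ _ _ _); exact: val_inj.
by rewrite row_mxEr.
Qed.

Lemma lift1_inj : injective (@lift1 R n).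
Proof. by move=> x y /rowP xy; apply/rowP => j; rewrite -!lift1_lift xy. Qed.

Lemma lift1_sum (I : finType) (b : {set I}) (w : I -> R) (p : I -> 'rV[R]_n) :
  \sum_(v in b) w v = 1 ->
  lift1 (\sum_(v in b) w v *: p v) = \sum_(v in b) w v *: lift1 (p v).
Proof.
move=> w1; apply/rowP => j; rewrite summxE.
have [k ->|->] := unliftP ord0 j.
  by rewrite lift1_lift summxE; apply: eq_bigr => v _; rewrite !mxE -lift1_lift mxE.
rewrite lift1_ord0 -w1; apply: eq_bigr => v _.
by rewrite mxE -[lift1 _]/(lift1 (p v)) lift1_ord0 mulr1.
Qed.

End Lift.

Section Simplices.
Variables (R : realType) (n : nat) (D : simplicial_complex R n).
Implicit Types (b c t : {set D}) (x : 'rV[R]_n.+1) (w : D -> R).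

Definition lpos (v : D) : 'rV[R]_n.+1 := lift1 (pos v).

Lemma lpos_ord0 v : lpos v ord0 ord0 = 1.
Proof. exact: lift1_ord0. Qed.

Lemma lpos_sum_ord0 b w : (\sum_(v in b) w v *: lpos v) ord0 ord0 = \sum_(v in b) w v.
Proof.
by rewrite summxE; apply: eq_bigr => v _; rewrite mxE lpos_ord0 mulr1.
Qed.

(** Terms of a convex combination that use the same vertex are merged by adding their weights. *)
Lemma simplexP b (y : 'rV[R]_n) : simplex b y <->
  exists w, [/\ forall v, 0 <= w v, \sum_(v in b) w v = 1
               & y = \sum_(v in b) w v *: pos v].
Proof.
split=> [[k [w [p [w0 w1 pb ->]]]]|[w [w0 w1 ->]]].
  have /choice [u uP] : forall j, exists v, v \in b /\ pos v = p j.
    by move=> j; have [v vb <-] := pb j; exists v.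
  exists (fun v => \sum_(j < k | u j == v) w j); split=> [v||].
  - exact: sumr_ge0.
  - rewrite -w1 [RHS](partition_big u (mem b)) //= => j _.
    by have [] := uP j.
  rewrite [LHS](partition_big u (mem b)) /= => [|j _]; last by have [] := uP j.
  apply: eq_bigr => v _; rewrite scaler_suml; apply: eq_bigr => j /eqP <-.
  by have [_ ->] := uP j.
exists #|b|, (fun j => w (enum_val j)), (fun j => pos (enum_val j)).
split=> // [|j|]; first by rewrite -w1 [RHS]big_enum_val.
  by exists (enum_val j) => //; exact: enum_valP.
by rewrite big_enum_val.
Qed.

(** The origin takes the weight that is missing to [1]. *)
Lemma hatP b x : hat b x <->
  exists w, [/\ forall v, 0 <= w v, \sum_(v in b) w v <= 1
               & x = \sum_(v in b) w v *: lpos v].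
Proof.
split=> [[k [w [p [w0 w1 pb ->]]]]|[w [w0 w1 ->]]].
  have /choice [u uP] : forall j, exists u : D -> R, [/\ forall v, 0 <= u v,
      \sum_(v in b) u v <= 1 & p j = \sum_(v in b) u v *: lpos v].
    move=> j; have [->|[y /simplexP[u [u0 u1 ->]] <-]] := pb j.
      by exists (fun=> 0); split=> //; rewrite big1 // => v _; rewrite scale0r.
    by exists u; split=> //; [rewrite u1 | rewrite lift1_sum].
  exists (fun v => \sum_j w j * u j v); split=> [v||].
  - by apply: sumr_ge0 => j _; rewrite mulr_ge0 //; have [] := uP j.
  - rewrite exchange_big /= -w1; apply: ler_sum => j _; rewrite -mulr_sumr.
    by rewrite ler_piMr //; have [] := uP j.
  rewrite (eq_bigr (fun j => \sum_(v in b) (w j * u j v) *: lpos v)).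
    rewrite exchange_big /=; apply: eq_bigr => v _; rewrite scaler_suml.
    exact: eq_bigr.
  move=> j _; have [_ _ ->] := uP j; rewrite scaler_sumr.
  by apply: eq_bigr => v _; rewrite scalerA.
(* Conversely, the point is [1 - N] times the origin plus [N] times a lifted point of the simplex;
   if [N = 0], it is the origin. *)
set N := \sum_(v in b) w v in w1.
have N0 : 0 <= N by exact: sumr_ge0.
have [NE|N_neq0] := eqVneq N 0.
  exists 1%N, (fun=> 1), (fun=> 0); split=> //; first by rewrite big_ord1.
    by left.
  rewrite big_ord1 scaler0 big1 // => v vb.
  by rewrite (psumr_eq0P _ NE) ?scale0r.
pose y := \sum_(v in b) (w v / N) *: pos v.
have yE : lift1 y = N^-1 *: \sum_(v in b) w v *: lpos v.
  rewrite lift1_sum -?mulr_suml ?mulfV // scaler_sumr.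
  by apply: eq_bigr => v _; rewrite scalerA mulrC.
exists 2%N, (fun j => if j == ord0 then 1 - N else N),
  (fun j => if j == ord0 then 0 else lift1 y); split.
- by move=> j; case: ifP => // _; rewrite subr_ge0.
- by rewrite !big_ord_recl big_ord0 /= addr0 subrK.
- move=> j; case: ifP => _; [by left | right; exists y => //].
  apply/simplexP; exists (fun v => w v / N); split=> //.
    by move=> v; rewrite divr_ge0.
  by rewrite -mulr_suml mulfV.
by rewrite !big_ord_recl big_ord0 /= addr0 scaler0 add0r yE scalerA mulfV ?scale1r.
Qed.

Lemma hat0 b : hat b 0.
Proof.
apply/hatP; exists (fun=> 0); split=> //; first by rewrite big1.
by rewrite big1 // => v _; rewrite scale0r.
Qed.

Lemma sum_extend b c (V : lmodType R) (u : D -> V) w : b \subset c ->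
  \sum_(v in c) (if v \in b then w v else 0) *: u v = \sum_(v in b) w v *: u v.
Proof.
move=> bc; rewrite (big_setID b) /= [X in _ + X]big1 ?addr0; last first.
  by move=> v; rewrite inE => /andP[/negPf -> _]; rewrite scale0r.
move/finset.setIidPr: (bc) => ->.
by apply: eq_bigr => v ->.
Qed.

Lemma hat_sub b c : b \subset c -> hat b `<=` hat c.
Proof.
move=> bc x /hatP[w [w0 w1 ->]]; apply/hatP.
exists (fun v => if v \in b then w v else 0); split.
- by move=> v; case: ifP.
- have := sum_extend (fun=> 1 : R^o) w bc; rewrite /GRing.scale /=.
  by under eq_bigr do rewrite mulr1; under [in RHS]eq_bigr do rewrite mulr1; move=> ->.
by rewrite sum_extend.
Qed.

Lemma simplex_sub b c : b \subset c -> simplex b `<=` simplex c.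
Proof.
move=> bc x /simplexP[w [w0 w1 ->]]; apply/simplexP.
exists (fun v => if v \in b then w v else 0); split.
- by move=> v; case: ifP.
- have := sum_extend (fun=> 1 : R^o) w bc; rewrite /GRing.scale /=.
  by under eq_bigr do rewrite mulr1; under [in RHS]eq_bigr do rewrite mulr1; move=> ->.
by rewrite sum_extend.
Qed.

(** Radial projection to the hyperplane [x_0 = 1]: the coordinate [x_0] is the sum of the weights,
    which is nonzero away from the origin. *)
Lemma hat_simplex b x : hat b x -> x != 0 ->
  exists2 y, simplex b y & x = x ord0 ord0 *: lift1 y.
Proof.
move=> /hatP[w [w0 w1 ->]]; rewrite lpos_sum_ord0; set N := \sum_(v in b) w v => x0.
have N_neq0 : N != 0.
  apply: contra_neq x0 => NE; rewrite big1 // => v vb.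
  by rewrite (psumr_eq0P _ NE) ?scale0r.
have NN : \sum_(v in b) w v / N = 1 by rewrite -mulr_suml mulfV.
exists (\sum_(v in b) (w v / N) *: pos v).
  apply/simplexP; exists (fun v => w v / N); split=> // v.
  by rewrite divr_ge0 // sumr_ge0.
rewrite lift1_sum // scaler_sumr; apply: eq_bigr => v _.
by rewrite scalerA mulrCA mulfV // mulr1.
Qed.

Lemma simplex_hat b (y : 'rV[R]_n) : simplex b y <-> hat b (lift1 y).
Proof.
split=> [/simplexP[w [w0 w1 ->]]|yb].
  by apply/hatP; exists w; rewrite w1 lift1_sum.
have y_neq0 : lift1 y != 0.
  apply: contra_neq (@oner_neq0 R) => /rowP/(_ ord0).
  by rewrite lift1_ord0 mxE.
have [z zb] := hat_simplex yb y_neq0.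
by rewrite lift1_ord0 scale1r => /lift1_inj ->.
Qed.

Lemma hat_scale b x (e : R) : 0 <= e <= 1 -> hat b x -> hat b (e *: x).
Proof.
move=> /andP[e0 e1] /hatP[w [w0 w1 ->]]; apply/hatP; exists (fun v => e * w v).
split; first by move=> v; rewrite mulr_ge0.
  by rewrite -mulr_sumr mulr_ile1 // sumr_ge0.
by rewrite scaler_sumr; under eq_bigr do rewrite scalerA.
Qed.

Lemma hat_ord0 b x : hat b x -> 0 <= x ord0 ord0 <= 1.
Proof. by move=> /hatP[w [w0 w1 ->]]; rewrite lpos_sum_ord0 sumr_ge0. Qed.

(** Away from the origin, the radial projections of [x] to both simplices coincide, and
    [faces_inter] applies to that point. *)
Lemma hat_inter b c x : b \in faces D -> c \in faces D ->
  hat b x -> hat c x -> hat (b :&: c) x.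
Proof.
move=> bF cF xb xc; have [->|x0] := eqVneq x 0; first exact: hat0.
have [y yb xE] := hat_simplex xb x0; have [z zc xE'] := hat_simplex xc x0.
have N_neq0 : x ord0 ord0 != 0 by apply: contra_neq x0 => x00; rewrite xE x00 scale0r.
have yz : y = z by apply/lift1_inj/(scalerI N_neq0); rewrite -xE -xE'.
have yI : (simplex b `&` simplex c) y by split=> //; rewrite yz.
rewrite /simplex (faces_inter bF cF) in yI.
rewrite xE; apply: hat_scale; first exact: hat_ord0 xb.
exact/simplex_hat.
Qed.

Lemma hat_cone_scale b w : (forall v, 0 <= w v) -> forall e : R, 0 <= e ->
  e * \sum_(v in b) w v <= 1 -> hat b (e *: \sum_(v in b) w v *: lpos v).
Proof.
move=> w0 e e0 e1; apply/hatP; exists (fun v => e * w v); split.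
- by move=> v; rewrite mulr_ge0.
- by rewrite -mulr_sumr.
by rewrite scaler_sumr; under eq_bigr do rewrite scalerA.
Qed.

(** The coordinate [x_0] of the relation says that the weights sum to zero, so affine independence
    becomes linear independence. *)
Lemma lpos_free b w : b \in faces D -> \sum_(v in b) w v *: lpos v = 0 ->
  forall v, v \in b -> w v = 0.
Proof.
move=> bF /rowP w0; apply: (faces_affine_free bF).
  by rewrite -lpos_sum_ord0 w0 mxE.
apply/rowP => j; have := w0 (fintype.lift ord0 j).
rewrite !summxE mxE => w0j; rewrite mxE -[RHS]w0j.
by apply: eq_bigr => v _; rewrite mxE [RHS]mxE /lpos lift1_lift.
Qed.

Lemma jfacesE j b : (b \in jfaces D j) = (b \in faces D) && (#|b| == j.+1).
Proof. by rewrite inE. Qed.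

(** The [n.+1] lifted vertices form a basis; [L] is the dual basis, given by the columns of the
    inverse matrix. *)
Lemma barycentric c : c \in jfaces D n -> exists L : D -> 'cV[R]_n.+1,
  forall x, x = \sum_(v in c) (x *m L v) ord0 ord0 *: lpos v.
Proof.
rewrite jfacesE => /andP[cF /eqP cn].
pose A : 'M[R]_(#|c|, n.+1) := \matrix_i lpos (enum_val i).
have uA (u : 'rV[R]_(#|c|)) : u *m A = \sum_i u ord0 i *: lpos (enum_val i).
  by rewrite mulmx_sum_row; apply: eq_bigr => i _; rewrite rowK.
have Afree : row_free A.
  rewrite -kermx_eq0; apply/eqP/row_matrixP => i; rewrite row0.
  have : row i (kermx A) *m A = 0 by rewrite -row_mul mulmx_ker row0.
  set u := row i _; rewrite uA => u0; apply/rowP => j; rewrite [RHS]mxE.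
  (* Row coefficients become weights on vertices; the default [0] is taken only off [c]. *)
  pose w v := if [pick i | enum_val i == v] is Some i then u ord0 i else 0.
  have wE k : w (enum_val k) = u ord0 k.
    rewrite /w; case: pickP => [k' /eqP/enum_val_inj -> //|/(_ k)].
    by rewrite eqxx.
  rewrite -wE; apply: lpos_free cF _ _ (enum_valP j).
  by rewrite big_enum_val -[RHS]u0; apply: eq_bigr => k _; rewrite wE.
have [B AB] := row_freeP Afree.
(* [A] is square only through the equation [#|c| = n.+1], so a left and a right inverse are obtained
   separately and then identified. *)
have Afull : row_full A by rewrite /row_full (eqP Afree) cn.
have [B' BA] := row_fullP Afull.
have BB : B *m A = 1%:M.
  by rewrite -BA -[B in B *m A]mul1mx -BA -(mulmxA B') AB mulmx1.
exists (fun v => if [pick i | enum_val i == v] is Some i then col i B else 0) => x.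
rewrite big_enum_val /= -[LHS]mulmx1 -BB mulmxA uA; apply: eq_bigr => k _.
case: pickP => [k' /eqP/enum_val_inj -> |/(_ k)]; last by rewrite eqxx.
by congr (_ *: _); rewrite !mxE; apply: eq_bigr => j _; rewrite [col _ _ _ _]mxE.
Qed.

Lemma barycentric_lpos c (L : D -> 'cV[R]_n.+1) : c \in jfaces D n ->
  (forall x, x = \sum_(v in c) (x *m L v) ord0 ord0 *: lpos v) ->
  forall w, forall v, v \in c ->
    ((\sum_(u in c) w u *: lpos u) *m L v) ord0 ord0 = w v.
Proof.
rewrite jfacesE => /andP[cF _] LP w v vc; apply/eqP; rewrite -subr_eq0; apply/eqP.
pose z u := ((\sum_(u in c) w u *: lpos u) *m L u) ord0 ord0 - w u.
apply: (lpos_free (w := z) cF _ vc).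
rewrite /z; under eq_bigr do rewrite scalerBl.
by rewrite sumrB -LP subrr.
Qed.

End Simplices.

(** * Topology of the cones *)

Section LinearForms.
Variables (R : realType) (n : nat).
Local Notation S := (mpoly n.+1 R).
Implicit Types (a : 'cV[R]_n.+1) (x : 'rV[R]_n.+1).

Definition linform a : S := \sum_(j < n.+1) a j ord0 *: mpolyX R (mnm1 j).

Lemma peval_linform a x : peval (linform a) x = (x *m a) ord0 ord0.
Proof.
rewrite /peval raddf_sum mxE; apply: eq_bigr => j _.
by rewrite /= mevalZ mevalXU mulrC.
Qed.

Lemma ishomog1_linform (l : S) : l \is ishomog1 1 mdeg -> exists a, l = linform a.
Proof.
move=> lh; exists (\col_j mcoeff (mnm1 j) l); apply/mpolyP => m.
rewrite raddf_sum /=; have [m1|m1] := boolP (mdeg m == 1%N); last first.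
  rewrite (dhomog_nemf_coeff lh m1) big1 // => j _; rewrite mcoeffZ mcoeffX.
  case: eqP => [jm|_]; last by rewrite mulr0.
  by move: m1; rewrite -jm mdeg1 eqxx.
have /mdeg1P[j /eqP ->] := m1.
rewrite (bigD1 j) //= mcoeffZ mcoeffX eqxx mulr1 mxE big1 ?addr0 // => k kj.
by rewrite mcoeffZ mcoeffX eq_mnm1 (negPf kj) mulr0.
Qed.

Lemma linform_continuous a : continuous (fun x => (x *m a) ord0 ord0).
Proof.
rewrite (_ : (fun x => _) = peval (linform a)); first exact: peval_continuous.
by apply/funext => x; rewrite peval_linform.
Qed.

Lemma mulmx_suml1 (I : finType) (b : {set I}) (w : I -> R) (u : I -> 'rV[R]_n.+1) a :
  ((\sum_(v in b) w v *: u v) *m a) ord0 ord0 =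
  \sum_(v in b) w v * (u v *m a) ord0 ord0.
Proof.
rewrite mulmx_suml summxE; apply: eq_bigr => v _.
by rewrite -scalemxAl mxE.
Qed.

End LinearForms.

Section HatTopology.
Variables (R : realType) (n : nat) (D : simplicial_complex R n).
Implicit Types (b c t : {set D}) (x : 'rV[R]_n.+1).

Section Barycentric.
Variables (c : {set D}) (L : D -> 'cV[R]_n.+1).
Hypothesis cn : c \in jfaces D n.
Hypothesis LP : forall x, x = \sum_(v in c) (x *m L v) ord0 ord0 *: lpos v.

(** Half-space description of the cone: the bound on [x_0] belongs to the facet opposite to the
    origin. *)
Lemma hat_barycentric x : hat c x <->
  (forall v, v \in c -> 0 <= (x *m L v) ord0 ord0) /\ x ord0 ord0 <= 1.
Proof.
split=> [/hatP[w [w0 w1 ->]]|[x0 x1]].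
  split=> [v vc|]; first by rewrite (barycentric_lpos cn LP).
  by rewrite lpos_sum_ord0.
apply/hatP; exists (fun v => if v \in c then (x *m L v) ord0 ord0 else 0); split.
- by move=> v; case: ifPn => // vc; exact: x0.
- move: x1; rewrite {1}(LP x) lpos_sum_ord0 => x1.
  by rewrite (eq_bigr (fun v => (x *m L v) ord0 ord0)) // => v ->.
by rewrite {1}(LP x); apply: eq_bigr => v ->.
Qed.

Lemma hat_interior x : (forall v, v \in c -> 0 < (x *m L v) ord0 ord0) ->
  x ord0 ord0 < 1 -> interior (hat c) x.
Proof.
move=> x0 x1; rewrite /interior /=.
have Hv v : \forall y \near x, v \in c -> 0 < (y *m L v) ord0 ord0.
  have [vc|vc] := boolP (v \in c); last by near=> y.
  near=> y => _; near: y.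
  exact: cvgr_gt _ (@linform_continuous _ _ (L v) x) _ (x0 v vc).
have H : \forall y \near x, forall v, v \in c -> 0 < (y *m L v) ord0 ord0.
  exact: filter_forall Hv.
have H1 : \forall y \near x, (y : 'rV[R]_n.+1) ord0 ord0 < 1.
  exact: cvgr_lt _ (@coord_continuous _ _ _ ord0 ord0 x) _ x1.
apply: filterS2 H H1 => y y0 y1; apply/hat_barycentric; split; last exact: ltW.
by move=> v vc; apply/ltW/y0.
Unshelve. all: by end_near. Qed.

End Barycentric.

Lemma hat_closed c : c \in jfaces D n -> closed (hat c).
Proof.
move=> cn; have [L LP] := barycentric cn.
rewrite (_ : hat c = (\bigcap_(v in [set` c])
    ((fun x => (x *m L v) ord0 ord0) @^-1` [set y | 0 <= y])) `&`
    ((fun x => x ord0 ord0) @^-1` [set y | y <= 1])); last first.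
  by apply/seteqP; split=> x /(hat_barycentric cn LP).
apply: closedI.
  apply: closed_bigI => v _; apply: preimage_closed; last exact: closed_ge.
  by move=> x _; exact: linform_continuous.
apply: preimage_closed; last exact: closed_le.
by move=> x _; exact: coord_continuous.
Qed.

(** A point [x] of the cone is the limit of points moved slightly from [x] towards an interior point
    [z]. *)
Lemma hat_closure c : c \in jfaces D n -> hat c `<=` closure (interior (hat c)).
Proof.
move=> cn; have [L LP] := barycentric cn => x xc B Bx.
move: (cn); rewrite jfacesE => /andP[_ /eqP cN].
(* The [n.+1] weights of [z] are positive and sum to [(n+1)/(n+2) < 1], so [z] is interior. *)
pose e : R := n.+2%:R^-1; have e_gt0 : 0 < e by rewrite invr_gt0 ltr0n.
pose z := \sum_(v in c) e *: lpos v.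
have z0 : z ord0 ord0 < 1.
  rewrite /z lpos_sum_ord0 sumr_const cN -mulr_natr /e mulrC.
  by rewrite ltr_pdivrMr ?ltr0n // mul1r ltr_nat.
have cont : (fun h : R => x + h *: (z - x)) @ 0^'+ --> x.
  apply: cvg_at_right_filter.
  rewrite -[X in _ --> X]addr0 -(scale0r (z - x)).
  by apply: cvgD; [exact: cvg_cst | apply: cvgZl; exact: cvg_id].
have [h [h0 h1 Bh]] : exists h : R, [/\ 0 < h, h <= 1 & B (x + h *: (z - x))].
  have : \forall h \near (0 : R)^'+, [/\ 0 < h, h <= 1 & B (x + h *: (z - x))].
    near=> h; split; [by near: h; exact: nbhs_right_gt | | ].
      by near: h; apply: nbhs_right_le.
    by near: h; exact: cont.
  by move=> /filter_ex.
exists (x + h *: (z - x)); split=> //.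
have [x0 x1] := (hat_barycentric cn LP x).1 xc.
have h1' : 0 <= 1 - h by rewrite subr_ge0.
have E : x + h *: (z - x) = (1 - h) *: x + h *: z.
  by rewrite scalerBr scalerBl scale1r addrA addrAC.
rewrite E; apply: (hat_interior cn LP) => [v vc|].
  rewrite mulmxDl -!scalemxAl [X in 0 < X]mxE [X in X + _]mxE [X in _ + X]mxE.
  rewrite ltr_wpDl //; first by rewrite mulr_ge0 // x0.
  by rewrite mulr_gt0 // (barycentric_lpos cn LP).
rewrite [ltLHS]mxE [X in X + _]mxE [X in _ + X]mxE.
apply: lt_le_trans (_ : (1 - h) * 1 + h * 1 <= 1).
  by rewrite ler_ltD ?ler_wpM2l ?ltr_pM2l.
by rewrite !mulr1 subrK.
Unshelve. all: by end_near. Qed.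

Lemma lift1_continuous : continuous (@lift1 R n).
Proof.
move=> x A /nbhs_ballP[e e0 eA]; apply/nbhs_ballP; exists e => //= y xy.
apply: eA.
split=> // i j; rewrite (ord1 i).
have [k ->|->] := unliftP ord0 j; last by rewrite !lift1_ord0; exact: ballxx.
by rewrite !lift1_lift; apply: xy.2.
Qed.

Lemma simplex_closed c : c \in jfaces D n -> closed (simplex c).
Proof.
move=> cn; rewrite (_ : simplex c = @lift1 R n @^-1` hat c); last first.
  by apply/seteqP; split=> y /simplex_hat.
by apply: preimage_closed; [move=> x _; exact: lift1_continuous | exact: hat_closed].
Qed.

End HatTopology.

(** * Ideals of faces and order of vanishing *)

Section Homogenize.
Variables (R : realType) (n : nat).

(** For [p != 0], [mmeasure mdeg p] is the degree plus one, whence the predecessor; for [p = 0] both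
    sides vanish. *)
Lemma peval_homogenize (p : mpoly n R) (e : R) (y : 'rV[R]_n) :
  peval (homogenize p) (e *: lift1 y) = e ^+ (mmeasure mdeg p).-1 * peval p y.
Proof.
rewrite /homogenize /peval raddf_sum mevalE mulr_sumr.
rewrite [LHS]big_seq [RHS]big_seq; apply: eq_bigr => a ap /=.
rewrite mevalZ mevalX mulrCA; congr (_ * _).
rewrite big_ord_recl mnmE unlift_none /= mxE lift1_ord0 mulr1.
under eq_bigr do rewrite mnmE liftK /= mxE lift1_lift exprMn.
rewrite big_split /= mulrA; congr (_ * _).
rewrite prodrXr -mdegE -exprD.
by have := mmeasure_mnm_lt mdeg ap; case: mmeasure => // d a_le; rewrite subnK.
Qed.

End Homogenize.

Section Mhat.
Variables (R : realType) (n : nat) (D : simplicial_complex R n).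
Local Notation S := (mpoly n.+1 R).
Implicit Types (b c t : {set D}) (x : 'rV[R]_n.+1) (q : S).

Lemma mhat_vanishes b q x : b \in faces D -> mhat b q -> hat b x -> peval q x = 0.
Proof.
move=> bF + xb; move: q; apply: (ideal_span_min (Q := fun q => peval q x = 0)).
- exact: meval0.
- by move=> p q p0 q0; rewrite pevalD p0 q0 addr0.
move=> p _ [q q0 <-]; rewrite pevalM.
have [y yb ->] : exists2 y, simplex b y & x = x ord0 ord0 *: lift1 y.
  have [->|/(hat_simplex xb)//] := eqVneq x 0.
  (* The origin is [0] times the lift of any vertex. *)
  have /finset.set0Pn[v vb] := faces_neq0 bF.
  exists (pos v); last by rewrite mxE scale0r.
  exists 1%N, (fun=> 1), (fun=> pos v); split=> //; rewrite ?big_ord1 ?scale1r //.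
by rewrite peval_homogenize (q0 y yb) !mulr0.
Qed.

(** The form is the homogenization of its dehomogenization [p], provided that [p] has degree one. *)
Lemma mhat_linform b (a : 'cV[R]_n.+1) : b \in faces D ->
  (forall v, v \in b -> (lpos v *m a) ord0 ord0 = 0) -> mhat b (linform a).
Proof.
move=> bF a0; have /finset.set0Pn[v0 v0b] := faces_neq0 bF.
pose aS j := a (fintype.lift ord0 j) ord0.
pose p : mpoly n R := mpolyC n (a ord0 ord0) + \sum_(j < n) aS j *: mpolyX R (mnm1 j).
have pE y : peval p y = (lift1 y *m a) ord0 ord0.
  rewrite mxE big_ord_recl lift1_ord0 mul1r /peval mevalD mevalC raddf_sum.
  congr (_ + _); apply: eq_bigr => j _ /=.
  by rewrite mevalZ mevalXU lift1_lift mulrC.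
have p0 y : simplex b y -> peval p y = 0.
  move=> /simplexP[w [_ w1 ->]]; rewrite pE lift1_sum // mulmx_suml1.
  by apply: big1 => v vb; rewrite -/(lpos v) a0 ?mulr0.
have pC m : mcoeff m p =
    a ord0 ord0 * (m == mnm0)%:R + \sum_(j < n) aS j * (mnm1 j == m)%:R.
  rewrite mcoeffD mcoeffC eq_sym raddf_sum; congr (_ + _).
  by apply: eq_bigr => j _; rewrite /= mcoeffZ mcoeffX.
(* If [p] is constant, it is zero because it vanishes at a vertex of [b], and so is the form. *)
have [aS0|] := boolP [forall j, aS j == 0].
  have -> : linform a = 0; last exact: ideal_span0.
  have aS0' j : aS j = 0 by apply/eqP; move/forallP: aS0.
  apply: peval_eq0 => x; rewrite peval_linform mxE big_ord_recl.
  rewrite [X in _ + X]big1 => [|j _]; last by rewrite [X in _ * X]aS0' mulr0.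
  have := a0 _ v0b; rewrite mxE big_ord_recl lpos_ord0 mul1r.
  rewrite [X in _ + X]big1 => [|j _]; last by rewrite [X in _ * X]aS0' mulr0.
  by rewrite addr0 => ->; rewrite mulr0 addr0.
rewrite negb_forall => /existsP[j0 aj0].
have degp : (mmeasure mdeg p).-1 = 1%N.
  suff -> : mmeasure mdeg p = 2%N by [].
  apply/eqP; rewrite eqn_leq; apply/andP; split.
    rewrite mmeasureE; apply/bigmax_leqP_seq => m mp _.
    rewrite leqNgt; apply/negP => m2; move: mp; rewrite mcoeff_msupp pC => /eqP; apply.
    rewrite big1 => [|j _]; last first.
      by case: eqP => [mE|_]; [move: m2; rewrite -mE /= mdeg1 | rewrite mulr0].
    by case: eqP => [mE|_]; [move: m2; rewrite mE /= mdeg0 | rewrite mulr0 addr0].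
  rewrite -(mdeg1 j0); apply: mmeasure_mnm_lt; rewrite mcoeff_msupp pC.
  rewrite (bigD1 j0) //= eqxx mulr1 [X in _ + (_ + X)]big1 => [|j /negPf jj0].
    rewrite addr0 (_ : (_ == mnm0) = false) ?mulr0 ?add0r //.
    by rewrite -mdeg_eq0 mdeg1.
  by rewrite eq_mnm1 jj0 mulr0.
apply: sub_ideal_span; exists p => //=.
(* The two sides agree where [x_0 != 0]. *)
suff : mpolyX R (mnm1 ord0) * (homogenize p - linform a) = 0 :> S.
  move/eqP; rewrite mulf_eq0 subr_eq0 => /orP[/eqP X0|/eqP //].
  have := congr1 (fun q : S => peval q (lpos v0)) X0.
  by rewrite /peval mevalXU meval0 lpos_ord0 => /eqP; rewrite oner_eq0.
apply: peval_eq0 => x; rewrite pevalM pevalB {1}/peval mevalXU.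
have [->|x0] := eqVneq (x ord0 ord0) 0; first by rewrite mul0r.
pose y : 'rV[R]_n := \row_j (x ord0 (fintype.lift ord0 j) / x ord0 ord0).
have xE : x = x ord0 ord0 *: lift1 y.
  apply/rowP => j; rewrite mxE; have [k ->|->] := unliftP ord0 j.
    by rewrite lift1_lift mxE mulrCA mulfV ?mulr1.
  by rewrite lift1_ord0 mulr1.
rewrite {2 3}xE peval_homogenize degp expr1 pE peval_linform -scalemxAl [X in _ - X]mxE.
by rewrite subrr mulr0.
Qed.

Lemma vanishes_ideal_pow_mhat b d q : b \in faces D ->
  (forall x, hat b x -> vanishes d x q) -> ideal_pow (mhat b) d q.
Proof.
(* [P] maps into the row space of [A], which is the span of the cone over [b], and fixes it
   pointwise. *)
move=> bF q0; pose A : 'M[R]_(#|b|, n.+1) := \matrix_i lpos (enum_val i).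
pose P := pinvmx A *m A; pose h j := linform (col j P).
have hE j x : peval (h j) x = (x *m P) ord0 j.
  by rewrite peval_linform !mxE; apply: eq_bigr => k _; rewrite [col _ _ _ _]mxE.
apply: (taylor_ideal_pow (h := h)) => [a ad|j].
  apply: peval_eq0 => x; rewrite peval_subst.
  have -> : \row_j peval (h j) x = x *m P.
    by apply/rowP => j; rewrite mxE hE.
  rewrite /P mulmxA mulmx_sum_row.
  pose w v := if [pick i | enum_val i == v] is Some i then (x *m pinvmx A) ord0 i else 0.
  have -> : \sum_i (x *m pinvmx A) ord0 i *: row i A = \sum_(v in b) w v *: lpos v.
    rewrite [RHS]big_enum_val; apply: eq_bigr => i _ /=; rewrite rowK; congr (_ *: _).
    rewrite /w; case: pickP => [k /eqP/enum_val_inj -> //|/(_ i)].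
    by rewrite eqxx.
  (* The derivatives vanish on the cone, which is dense in its span. *)
  apply: peval_span => w' w0 w1; apply: q0 => //.
  by apply/hatP; exists w'.
(* The components of [X - X P] are linear forms that vanish on the cone over [b]. *)
have -> : mpolyX R (mnm1 j) - h j = linform (col j (1%:M - P)).
  apply/eqP; rewrite -subr_eq0; apply/eqP/peval_eq0 => x.
  rewrite !pevalB hE peval_linform /peval mevalXU.
  have -> : (x *m col j (1%:M - P)) ord0 ord0 = (x *m (1%:M - P)) ord0 j.
    by rewrite !mxE; apply: eq_bigr => k _; rewrite [col _ _ _ _]mxE.
  by rewrite mulmxBr mulmx1 [X in _ - X]mxE [X in _ - (_ + X)]mxE subrr.
apply: mhat_linform => // v vb.
have -> : (lpos v *m col j (1%:M - P)) ord0 ord0 = (lpos v *m (1%:M - P)) ord0 j.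
  by rewrite !mxE; apply: eq_bigr => k _; rewrite [col _ _ _ _]mxE.
rewrite mulmxBr mulmx1 (_ : lpos v *m P = lpos v) ?subrr ?mxE //.
rewrite /P mulmxA mulmxKpV // (_ : lpos v = row (enum_rank_in vb v) A) ?row_sub //.
by rewrite rowK enum_rankK_in.
Qed.

Lemma ideal_pow_mhat_vanishes b d q x : b \in faces D ->
  ideal_pow (mhat b) d q -> hat b x -> vanishes d x q.
Proof.
move=> bF qI xb; apply: ideal_pow_vanishes qI => g gb.
exact: mhat_vanishes bF gb xb.
Qed.

Lemma ideal_span_X_vanishes (l : S) d q x :
  ideal_span [set l ^+ d] q -> peval l x = 0 -> vanishes d x q.
Proof.
move=> qI lx; apply: (@ideal_pow_vanishes _ _ [set l]) => [g -> //|].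
move: q qI; apply: (ideal_span_min (Q := ideal_pow [set l] d)).
- exact: ideal_span0.
- by move=> p q; exact: ideal_spanD.
by move=> a _ ->; apply: ideal_spanM; exact: ideal_powX.
Qed.

Lemma jfaces_setD c t : (0 < n)%N -> c \in jfaces D n -> t \in jfaces D n.-1 ->
  t \subset c -> exists2 v, v \notin t & c = v |: t.
Proof.
rewrite !jfacesE => n0 /andP[cF /eqP cN] /andP[tF /eqP tN] tc.
have /eqP/cards1P[v cv] : #|c :\: t| = 1%N.
  rewrite cardsD; move/finset.setIidPr: (tc) => ->; rewrite cN tN prednK //.
  exact: subSnn.
exists v.
  have : v \in c :\: t by rewrite cv finset.set11.
  by rewrite inE => /andP[].
by rewrite -cv finset.setUC -[X in X :|: _](finset.setIidPr tc) finset.setID.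
Qed.

(** Here the projection is along the vertex [v] of [c] opposite to [t], so that the components of
    [X - h] are multiples of [l], and a product of [d] multiples of [l] is a multiple of
    [l ^+ d]. *)
Lemma vanishes_ideal_span_X c t (l : S) d q : (0 < n)%N ->
  c \in jfaces D n -> t \in jfaces D n.-1 -> t \subset c ->
  l \is ishomog1 1 mdeg -> l != 0 -> (forall x, hat t x -> peval l x = 0) ->
  (forall x, hat t x -> vanishes d x q) -> ideal_span [set l ^+ d] q.
Proof.
move=> n0 cn tn tc /ishomog1_linform[a lE] l_neq0 l0 q0.
have [v vt cE] := jfaces_setD n0 cn tn tc; have [L LP] := barycentric cn.
have lt u : u \in t -> (lpos u *m a) ord0 ord0 = 0.
  move=> ut; rewrite -peval_linform -lE; apply: l0; apply/simplex_hat.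
  exists 1%N, (fun=> 1), (fun=> pos u); split=> //; rewrite ?big_ord1 ?scale1r //.
have lx (w : D -> R) : peval l (\sum_(u in c) w u *: lpos u) = w v * peval l (lpos v).
  rewrite lE !peval_linform mulmx_suml1 cE big_setU1 //= big1 ?addr0 // => u ut.
  by rewrite lt // mulr0.
set lv := peval l (lpos v) in lx.
(* The lifted vertices of [c] form a basis, and [l] vanishes on those of [t]. *)
have lv0 : lv != 0.
  apply: contra_neq l_neq0 => lv0; apply: peval_eq0 => x.
  by rewrite (LP x) lx lv0 mulr0.
pose h j := mpolyX R (mnm1 j) - (lpos v ord0 j / lv) *: l.
have qI : ideal_pow [set g | exists e : S, g = e * l] d q.
  apply: (taylor_ideal_pow (h := h)) => [m md|j]; last first.
    by exists (mpolyC n.+1 (lpos v ord0 j / lv)); rewrite /h opprB addrC subrK mul_mpolyC.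
  apply: peval_eq0 => x; rewrite peval_subst.
  have -> : \row_j peval (h j) x = x - (peval l x / lv) *: lpos v.
    apply/rowP => j; rewrite mxE /h pevalB {1 2}/peval mevalXU mevalZ -/(peval l x).
    rewrite [RHS]mxE [X in _ = _ + X]mxE [X in _ = _ - X]mxE; congr (_ - _).
    by rewrite mulrC mulrA [RHS]mulrAC.
  have -> : x - (peval l x / lv) *: lpos v = \sum_(u in t) (x *m L u) ord0 ord0 *: lpos u.
    rewrite [in LHS](LP x) lx mulfK // [in X in X - _]cE big_setU1 //=.
    by rewrite addrAC subrr add0r.
  apply: (peval_span _ (fun u => (x *m L u) ord0 ord0)) => w w0 w1; apply: q0 => //.
  by apply/hatP; exists w.
move: q {q0} qI; apply: (ideal_span_min (Q := ideal_span [set l ^+ d])).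
- exact: ideal_span0.
- by move=> p q; exact: ideal_spanD.
move=> e _ [g gl ->]; apply: ideal_spanM.
have /choice [f fE] := gl; under eq_bigr do rewrite fE.
rewrite big_split /= prodr_const card_ord; apply: ideal_spanM.
exact: sub_ideal_span.
Qed.

End Mhat.

(** * Incidence numbers *)

Section Incidence.
Variables (R : realType) (n : nat) (D : simplicial_complex R n).
Hypothesis n_gt0 : (0 < n)%N.
Implicit Types (b c t : {set D}) (x : 'rV[R]_n.+1).

(* [a] is the normal of the hyperplane spanned by the cone over [t]; its
   entries are the cofactors of the first row of the incidence matrix. *)
Lemma incidence_normal t : t \in jfaces D n.-1 -> exists a : 'cV[R]_n.+1,
  (forall u, u \in t -> (lpos u *m a) ord0 ord0 = 0) /\
  (forall c v, c \in jfaces D n -> v \notin t -> c = v |: t ->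
     incidence c t = Num.sg ((lpos v *m a) ord0 ord0) /\
     (lpos v *m a) ord0 ord0 != 0).
Proof.
move=> tn; move: (tn); rewrite jfacesE => /andP[_ /eqP tN].
pose s := [seq lpos u | u <- enum t].
have sN : size s = n by rewrite size_map -cardE tN prednK.
pose M (x : 'rV[R]_n.+1) : 'M[R]_n.+1 := \matrix_(k < n.+1) nth 0 (x :: s) k.
(* The cofactors of the first row do not depend on that row, so it may be taken to be [0]. *)
pose a : 'cV[R]_n.+1 := \col_j cofactor (M 0) ord0 j.
have Ma x : \det (M x) = (x *m a) ord0 ord0.
  rewrite (expand_det_row _ ord0) mxE; apply: eq_bigr => j _.
  rewrite !mxE; congr (_ * (_ * \det _)).
  by apply/matrixP => k k'; rewrite !mxE.
exists a; split=> [u ut|c v cn vt cE].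
  rewrite -Ma; pose k := index u (enum t).
  have kn : (k < n)%N by rewrite -sN size_map index_mem mem_enum.
  (* The row [lpos u] occurs twice in [M (lpos u)]. *)
  apply: (@determinant_alternate _ _ _ ord0 (fintype.lift ord0 (Ordinal kn))) => // j.
  rewrite [LHS]mxE [RHS]mxE /= (nth_map u) ?nth_index ?mem_enum //.
  by rewrite index_mem mem_enum.
have tc : t \subset c by rewrite cE finset.subsetUr.
have cv : c :\: t = finset.set1 v.
  rewrite cE finset.setDUl finset.setDv finset.setU0; apply/finset.setDidPl.
  by rewrite disjoints1.
rewrite /incidence tc cv enum_set1 -Ma; split; first by [].
(* The rows of the matrix include the basis of lifted vertices of [c]. *)
suff : M (lpos v) \in unitmx by rewrite unitmxE unitfE.
have [L LP] := barycentric cn.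
rewrite -row_full_unit -sub1mx; apply/row_subP => i.
rewrite {1}(LP (row i 1%:M)); apply: summx_sub => u uc; apply: scalemx_sub.
have u_s : lpos u \in lpos v :: s.
  move: uc; rewrite cE !inE => /orP[/eqP -> |ut]; first by rewrite eqxx.
  by apply/orP; right; apply/mapP; exists u; rewrite ?mem_enum.
have kn : (index (lpos u) (lpos v :: s) < n.+1)%N.
  by have := u_s; rewrite -index_mem /= sN.
have -> : lpos u = row (Ordinal kn) (M (lpos v)).
  by rewrite rowK /= nth_index.
exact: row_sub.
Qed.

(** Two distinct sets of [n.+1] vertices share at most [n] of them, and [t] already has [n]. *)
Lemma jfaces_setI t c c' : t \in jfaces D n.-1 -> c \in jfaces D n ->
  c' \in jfaces D n -> t \subset c -> t \subset c' -> c != c' -> c :&: c' = t.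
Proof.
rewrite !jfacesE => /andP[_ /eqP tN] /andP[_ /eqP cN] /andP[_ /eqP cN'] tc tc' cc'.
apply/eqP; rewrite eq_sym eqEcard finset.subsetI tc tc' /= tN prednK // -ltnS -cN.
apply: proper_card; rewrite properE finset.subsetIl /=.
apply: contra cc'; rewrite finset.subsetI => /andP[_ cc'].
by rewrite eqEcard cc' cN cN' leqnn.
Qed.

(* If [c] and [c'] were on the same side of [t], then the cones over them would
   share points outside the hyperplane spanned by the cone over [t]. *)
Lemma incidence_opp t c c' : t \in jfaces D n.-1 -> c \in jfaces D n ->
  c' \in jfaces D n -> t \subset c -> t \subset c' -> c != c' ->
  incidence c t != 0 /\ incidence c' t = - incidence c t.
Proof.
move=> tn cn cn' tc tc' cc'.
have [a [ta aP]] := incidence_normal tn.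
have [v vt cE] := jfaces_setD n_gt0 cn tn tc.
have [v' vt' cE'] := jfaces_setD n_gt0 cn' tn tc'.
have [-> d0] := aP c v cn vt cE; have [-> d0'] := aP c' v' cn' vt' cE'.
set d := (lpos v *m a) ord0 ord0 in d0 *; set d' := (lpos v' *m a) ord0 ord0 in d0' *.
split; first by rewrite sgr_eq0.
have [dd'|dd'] := ltP (d * d') 0.
  have := sgrM d d'; rewrite (ltr0_sg dd') => E.
  have := congr1 (fun z => z * Num.sg d) E.
  by rewrite mulrAC -expr2 sqr_sg d0 mul1r mulN1r => <-.
have {}dd' : 0 < d * d' by rewrite lt_def mulf_neq0.
have [L LP] := barycentric cn.
have asum (w : D -> R) : ((\sum_(u in c) w u *: lpos u) *m a) ord0 ord0 = w v * d.
  rewrite mulmx_suml1 cE big_setU1 //= big1 ?addr0 // => u ut.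
  by rewrite ta // mulr0.
(* As [d] and [d'] have the same sign, [z] lies in the hyperplane of [t] and is a combination of the
   vertices of [t], with coefficients [al]. *)
pose z := `|d'| *: lpos v - `|d| *: lpos v'.
have za : (z *m a) ord0 ord0 = 0.
  rewrite mulmxBl -!scalemxAl [LHS]mxE [X in X + _]mxE [X in _ + X]mxE [X in _ - X]mxE.
  rewrite -/d -/d'; have [d_gt0|d_lt0|dz] := ltgtP 0 d.
  - move: dd'; rewrite pmulr_rgt0 // => d_gt0'.
    by rewrite !gtr0_norm // mulrC subrr.
  - move: dd'; rewrite nmulr_rgt0 // => d_lt0'.
    by rewrite !ltr0_norm // !mulNr mulrC subrr.
  by move: d0; rewrite -dz eqxx.
pose al u := (z *m L u) ord0 ord0.
have alv : al v = 0.
  by move: za; rewrite (LP z) asum => /eqP; rewrite mulf_eq0 (negPf d0) orbF => /eqP.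
have zt : z = \sum_(u in t) al u *: lpos u.
  by rewrite [LHS](LP z) [in LHS]cE big_setU1 //= -/(al v) alv scale0r add0r.
(* Both expressions of [z] show that [v] with weight [|d'|] plus the [u] in [t] with weights
   [B - al u] gives the same point as [v'] with weight [|d|] plus the [u] with weights [B]; the
   bound [B] makes all weights nonnegative. *)
pose B := \sum_(u in t) `|al u|.
have B_ge u : u \in t -> `|al u| <= B.
  by move=> ut; rewrite /B (bigD1 u) //= lerDl sumr_ge0.
have B0 : 0 <= B by exact: sumr_ge0.
pose w u := if u == v then `|d'| else if u \in t then B - al u else 0.
pose w' u := if u == v' then `|d| else B.
have w0 u : 0 <= w u.
  rewrite /w; case: ifP => // _; case: ifPn => // ut.
  by rewrite subr_ge0 (le_trans (ler_norm _)) ?B_ge.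
have w0' u : 0 <= w' u by rewrite /w'; case: ifP.
have ww' : \sum_(u in c) w u *: lpos u = \sum_(u in c') w' u *: lpos u.
  rewrite cE cE' !big_setU1 //= {1}/w eqxx.
  have -> : \sum_(u in t) w u *: lpos u = \sum_(u in t) B *: lpos u - z.
    rewrite zt -sumrB; apply: eq_bigr => u ut.
    rewrite /w ut; case: eqP => [uv|_]; last by rewrite scalerBl.
    by move: vt; rewrite -uv ut.
  have -> : \sum_(u in t) w' u *: lpos u = \sum_(u in t) B *: lpos u.
    apply: eq_bigr => u ut; rewrite /w'; case: eqP => // uv.
    by move: vt'; rewrite -uv ut.
  by rewrite /w' eqxx /z opprB addrC -addrA subrK addrC.
(* Scaling by [N^-1] makes the weights sum to at most [1], which puts the common point in both
   cones. *)
pose N := 1 + \sum_(u in c) w u.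
have N_gt0 : 0 < N by rewrite ltr_pwDl // sumr_ge0.
have N_ge : N^-1 * \sum_(u in c) w u <= 1.
  by rewrite mulrC ler_pdivrMr // mul1r lerDr.
have N_ge' : N^-1 * \sum_(u in c') w' u <= 1.
  by rewrite -lpos_sum_ord0 -ww' lpos_sum_ord0.
have Ni0 : 0 <= N^-1 by rewrite invr_ge0 ltW.
have zc := hat_cone_scale w0 Ni0 N_ge.
have zc' := hat_cone_scale w0' Ni0 N_ge'; rewrite -ww' in zc'.
move: (cn) (cn'); rewrite !jfacesE => /andP[cF _] /andP[cF' _].
(* The common point then lies in the cone over [t], where [a] vanishes, although its weight on [v]
   is nonzero. *)
have := hat_inter cF cF' zc zc'; rewrite (jfaces_setI tn cn cn' tc tc' cc').
move=> /hatP[w2 [_ _ E]]; have := congr1 (fun y => (y *m a) ord0 ord0) E.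
rewrite /= -scalemxAl [LHS]mxE asum mulmx_suml1 big1; last first.
  by move=> u ut; rewrite ta // mulr0.
move/eqP; rewrite !mulf_eq0 invr_eq0 (gt_eqF N_gt0) (negPf d0) /= orbF.
by rewrite /w eqxx normr_eq0 (negPf d0').
Qed.

End Incidence.

(** * Smoothness of piecewise polynomial functions *)

Section Ck.
Variables (R : realType) (n : nat).
Local Notation S := (mpoly n.+1 R).
Implicit Types (p q : S) (x : 'rV[R]_n.+1) (f : 'rV[R]_n.+1 -> R) (C : set 'rV[R]_n.+1).

Lemma within_continuous_closure C U f p : {within C, continuous f} ->
  U `<=` C -> (forall x, U x -> f x = peval p x) ->
  forall x, C x -> closure U x -> f x = peval p x.
Proof.
move=> cf UC fU x Cx clx; apply/eqP; apply/negPn/negP; rewrite -subr_eq0 => fx.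
pose g y := f y - peval p y.
have cg : g y @[y --> within C (nbhs x)] --> g x.
  have /subspace_continuousP/(_ x Cx) fc := cf.
  apply: cvgB => //; apply: cvg_within_filter; exact: peval_continuous.
have : \forall y \near within C (nbhs x), `|g x - g y| < `|g x|.
  by move/cvgr_dist_lt : cg; apply; rewrite normr_gt0.
rewrite /within /= => /clx[y [Uy]] /(_ (UC y Uy)).
by rewrite /g (fU y Uy) subrr subr0 ltxx.
Qed.

(** Induction on [k]: the extended partial derivative [g] is the derivative of [p1] on [C1] and of
    [p2] on [C2], and [g] is of class one less. *)
Lemma Ck_on_mderivm k C C1 C2 f p1 p2 : Ck_on k C f ->
  C1 `<=` C -> C2 `<=` C ->
  C1 `<=` closure (interior C1) -> C2 `<=` closure (interior C2) ->
  (forall x, C1 x -> f x = peval p1 x) -> (forall x, C2 x -> f x = peval p2 x) ->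
  forall x, C1 x -> C2 x -> vanishes k.+1 x (p1 - p2).
Proof.
move=> + C1C C2C cl1 cl2; elim: k f p1 p2 => [|k ih] f p1 p2 Cf f1 f2 x C1x C2x.
  apply: vanishes_deriv => //.
  by rewrite pevalB -f1 // -f2 // subrr.
case: (Cf) => _ df; apply: vanishes_deriv => [|j].
  by rewrite pevalB -f1 // -f2 // subrr.
have [g Cg gP] := df j.
have cg : {within C, continuous g} by case: (k) Cg => [|k'] [].
(* The equality holds in the interior, where derivatives are local, and passes to the closure by
   continuity of [g]. *)
have gE B p : B `<=` C -> B `<=` closure (interior B) ->
    (forall y, B y -> f y = peval p y) -> forall y, B y -> g y = peval (mderiv j p) y.
  move=> BC clB fB y By.
  apply: (within_continuous_closure (U := interior B) cg) => [|z Bz||].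
  - by move=> z /interior_subset /BC.
  - rewrite -(@derive_val _ _ _ _ _ _ _ (gP z (interiorS BC Bz))).
    have zp : \forall u \near z, f u = peval p u.
      by apply: filterS Bz => u /fB.
    by rewrite (near_eq_derive _ zp) (@derive_val _ _ _ _ _ _ _ (peval_is_derive p j z)).
  - exact: BC.
  - exact: clB.
by rewrite mderivB; apply: (ih g) => //; exact: gE.
Qed.

(** Near [x], each difference quotient of [f] is one of the two polynomial quotients, and both tend
    to [d]. *)
Lemma is_derive_paste f p1 p2 x (v : 'rV[R]_n.+1) (d : R) :
  (\forall y \near x, f y = peval p1 y \/ f y = peval p2 y) ->
  peval p1 x = peval p2 x ->
  is_derive x v (peval p1) d -> is_derive x v (peval p2) d -> is_derive x v f d.
Proof.
move=> fp p12 d1 d2.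
have fx : f x = peval p1 x by case: (nbhs_singleton fp) => ->.
pose q (F : 'rV[R]_n.+1 -> R) (h : R) := h^-1 *: ((F \o shift x) (h *: v) - F x) : R^o.
have cq F : is_derive x v F d -> q F @ 0^' --> (d : R^o).
  by case=> Fd <-; exact: Fd.
have cf : q f @ 0^' --> (d : R^o).
  apply/cvgrPdist_lt => e e0.
  have c1 := cvgr_dist_lt _ _ (cq _ d1) e e0.
  have c2 := cvgr_dist_lt _ _ (cq _ d2) e e0.
  have c0 : \forall h \near (0 : R)^', f (h *: v + x) = peval p1 (h *: v + x) \/
                                        f (h *: v + x) = peval p2 (h *: v + x).
    apply: nbhs_dnbhs.
    have lim_hv : (h *: v + x) @[h --> (0 : R)] --> x.
      rewrite -[X in _ --> X]add0r -(scale0r v).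
      by apply: cvgD; [apply: cvgZl; exact: cvg_id | exact: cvg_cst].
    exact: lim_hv _ fp.
  near=> h; have [fh|fh] : f (h *: v + x) = peval p1 (h *: v + x) \/
                          f (h *: v + x) = peval p2 (h *: v + x) by near: h.
    have -> : q f h = q (peval p1) h by rewrite /q /= fh fx.
    near: h; exact: c1.
  have -> : q f h = q (peval p2) h by rewrite /q /= fh fx p12.
  near: h; exact: c2.
by apply: DeriveDef; [exact: cvgP cf | exact/cvg_lim].
Unshelve. all: by end_near. Qed.

Lemma within_continuous_paste C1 C2 f p1 p2 : closed C1 -> closed C2 ->
  (forall x, C1 x -> f x = peval p1 x) -> (forall x, C2 x -> f x = peval p2 x) ->
  {within C1 `|` C2, continuous f}.
Proof.
move=> cl1 cl2 f1 f2; apply: withinU_continuous => //.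
  apply: (@subspace_eq_continuous _ _ _ (peval p1)).
    by move=> x; rewrite inE => /f1.
  by apply: continuous_subspaceT; exact: peval_continuous.
apply: (@subspace_eq_continuous _ _ _ (peval p2)).
  by move=> x; rewrite inE => /f2.
by apply: continuous_subspaceT; exact: peval_continuous.
Qed.

(** The partial derivatives of [p1] and [p2] agree on the overlap to one order less, so they paste
    to a function [g] to which the induction applies. *)
Lemma Ck_on_paste k C1 C2 f p1 p2 : closed C1 -> closed C2 ->
  (forall x, C1 x -> f x = peval p1 x) -> (forall x, C2 x -> f x = peval p2 x) ->
  (forall x, C1 x -> C2 x -> vanishes k.+1 x (p1 - p2)) -> Ck_on k (C1 `|` C2) f.
Proof.
move=> cl1 cl2; elim: k f p1 p2 => [|k ih] f p1 p2 f1 f2 p12.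
  by split=> //; exact: within_continuous_paste f1 f2.
split; [exact: within_continuous_paste f1 f2 | move=> j].
pose g x := if `[< C1 x >] then peval (mderiv j p1) x else peval (mderiv j p2) x.
have g1 x : C1 x -> g x = peval (mderiv j p1) x by rewrite /g => /asboolT ->.
have D12 x : C1 x -> C2 x -> vanishes k.+1 x (mderiv j p1 - mderiv j p2).
  by move=> C1x C2x; rewrite -mderivB; apply: vanishes_mderiv; exact: p12.
have g2 x : C2 x -> g x = peval (mderiv j p2) x.
  move=> C2x; rewrite /g; case: asboolP => // C1x.
  apply/eqP; rewrite -subr_eq0 -pevalB; apply/eqP.
  by have := D12 x C1x C2x mnm0; rewrite mderivm0m mdeg0 => ->.
exists g; first exact: ih g1 g2 D12.
move=> x Cx.
(* Off the closed set [B], [f] coincides with [p] near [x]. *)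
have far (A B : set 'rV[R]_n.+1) p : closed B -> interior (A `|` B) x -> ~ B x ->
    (forall y, A y -> f y = peval p y) -> is_derive x (delta_mx ord0 j) f (peval (mderiv j p) x).
  move=> clB ABx nBx fA; apply: near_eq_is_derive (peval_is_derive p j x).
  have nB : \forall y \near x, ~ B y by apply: open_nbhs_nbhs; split=> //; exact: closed_openC.
  by apply: filterS2 ABx nB => y [/fA ->|].
have [C1x|nC1x] := pselect (C1 x); last first.
  rewrite g2; last by case: (interior_subset Cx).
  by apply: (far C2 C1) => //; rewrite setUC.
have [C2x|nC2x] := pselect (C2 x); last by rewrite g1 //; apply: (far C1 C2).
apply: (@is_derive_paste _ p1 p2).
- apply: filterS Cx => y [/f1|/f2]; tauto.
- by rewrite -f1 // -f2.
- by rewrite g1 //; exact: peval_is_derive.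
- by rewrite g2 //; exact: peval_is_derive.
Qed.

End Ck.

(** * Combinatorics of the complex *)

Section Complex.
Variables (R : realType) (n : nat) (D : simplicial_complex R n).
Local Notation S := (mpoly n.+1 R).
Implicit Types (b c t : {set D}) (x : 'rV[R]_n.+1).

Lemma peval_hat_inj c (p q : S) : c \in jfaces D n ->
  (forall x, hat c x -> peval p x = peval q x) -> p = q.
Proof.
move=> cn pq; apply/eqP; rewrite -subr_eq0; apply/eqP/peval_eq0 => x.
have [L LP] := barycentric cn; rewrite (LP x).
apply: (peval_span _ (fun u => (x *m L u) ord0 ord0)) => w w0 w1.
by rewrite pevalB pq ?subrr //; apply/hatP; exists w.
Qed.

Lemma simplex_set0 (y : 'rV[R]_n) : ~ simplex (finset.set0 : {set D}) y.
Proof.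
by move=> /simplexP[w [_]]; rewrite big_set0 => /eqP; rewrite eq_sym oner_eq0.
Qed.

Lemma hat_set0 x : hat (finset.set0 : {set D}) x -> x = 0.
Proof. by move=> /hatP[w [_ _ ->]]; rewrite big_set0. Qed.

Lemma simplex_vertex b v : v \in b -> simplex b (pos v).
Proof.
move=> vb; exists 1%N, (fun=> 1), (fun=> pos v).
by split=> //; rewrite ?big_ord1 ?scale1r.
Qed.

(** Packages the chains of [hereditary]: a reflexive and transitive relation has to be checked only
    across single interior facets that contain [c :&: c']. *)
Lemma hereditary_ind (Q : {set D} -> {set D} -> Prop) c c' : hereditary D ->
  c \in jfaces D n -> c' \in jfaces D n -> c :&: c' != finset.set0 ->
  (forall d, Q d d) -> (forall d e f, Q d e -> Q e f -> Q d f) ->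
  (forall d e, d \in jfaces D n -> e \in jfaces D n ->
     d :&: e \in int_jfaces D n.-1 -> c :&: c' \subset d :&: e -> Q d e) ->
  Q c c'.
Proof.
move=> H cn cn' cc' Qdd Qtr Qstep; have [p [pth pl pP]] := H c c' cn cn' cc'.
move: pl pth pP; set I := c :&: c' in Qstep *; move: (c) => c0.
elim: p c0 => [|d p ih] c0 /=; first by move=> ->.
move=> pl /andP[c0d dp] pP.
have /andP[c0n c0I] := pP c0 (mem_head _ _).
have /andP[dn dI] : (d \in jfaces D n) && (I \subset d).
  by apply: pP; rewrite !inE eqxx orbT.
apply: (Qtr _ d); first by apply: Qstep; rewrite // finset.subsetI c0I.
by apply: ih => // e ep; apply: pP; rewrite inE ep orbT.
Qed.

Lemma pure_subset b : pure D -> b \in faces D -> exists2 c, c \in jfaces D n & b \subset c.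
Proof.
move=> [_ H] bF; have [c cmax bc] := maxset_exists (P := [in faces D]) bF.
by exists c => //; exact: H.
Qed.

(** Purity gives one coface and the exclusion of the boundary a second; three cofaces would have
    nonzero, pairwise opposite incidence numbers. *)
Lemma int_jfaces_cofaces t : (0 < n)%N -> pure D -> t \in int_jfaces D n.-1 ->
  exists c c', [/\ c \in jfaces D n, c' \in jfaces D n, c != c', c :&: c' = t &
    forall d, d \in jfaces D n -> t \subset d -> (d == c) || (d == c')].
Proof.
move=> n_gt0 pD; rewrite inE => /andP[tB tn].
move: (tn); rewrite jfacesE => /andP[tF _].
have [c cn tc] := pure_subset pD tF.
have [c' [cn' tc' cc']] : exists c', [/\ c' \in jfaces D n, t \subset c' & c != c'].
  apply: contrapT => H; move/negP: tB; apply; rewrite inE tF /=.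
  apply/existsP; exists t; rewrite tn subxx /=.
  apply/cards1P; exists c; apply/finset.setP => c'; rewrite !inE.
  have [->|cc'] := eqVneq c' c; first by rewrite -jfacesE cn tc.
  apply/negP => /andP[cn' tc']; apply: H; exists c'; split=> //.
    by rewrite jfacesE.
  by rewrite eq_sym.
exists c, c'; split=> // [|d dn td]; first exact: jfaces_setI.
apply: contraT; rewrite negb_or => /andP[dc dc'].
have [inc0 incE] := incidence_opp n_gt0 tn cn cn' tc tc' cc'.
have [_ incE1] := incidence_opp n_gt0 tn dn cn td tc dc.
have [_ incE2] := incidence_opp n_gt0 tn dn cn' td tc' dc'.
move/eqP: incE; rewrite incE2 -incE1 -addr_eq0 -mulr2n mulrn_eq0 /=.
by rewrite (negPf inc0).
Qed.

Lemma coneE : pure D -> cone D = \bigcup_(c in [set` jfaces D n]) hat c.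
Proof.
move=> pD; apply/seteqP; split=> x.
  move=> [->|[b bF xb]].
    case: (pD) => /finset.set0Pn[c cn] _; exists c => //; exact: hat0.
  have [c cn bc] := pure_subset pD bF.
  by exists c => //; exact: hat_sub bc _ xb.
move=> [c cn xc]; right; exists c => //=.
by move: cn; rewrite /= jfacesE => /andP[].
Qed.

Lemma polyhedronE : pure D -> polyhedron D = \bigcup_(c in [set` jfaces D n]) simplex c.
Proof.
move=> pD; apply/seteqP; split=> x.
  move=> [b bF xb]; have [c cn bc] := pure_subset pD bF.
  by exists c => //; exact: simplex_sub bc _ xb.
move=> [c cn xc]; exists c => //=.
by move: cn; rewrite /= jfacesE => /andP[].
Qed.

Lemma within_cone_continuous (f : 'rV[R]_n.+1 -> R) (P : {set D} -> S) : pure D ->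
  (forall c x, c \in jfaces D n -> hat c x -> f x = peval (P c) x) ->
  {within cone D, continuous f}.
Proof.
move=> pD fP; rewrite coneE //.
have -> : [set` jfaces D n] = [set` enum (jfaces D n)].
  by apply/seteqP; split=> c /=; rewrite mem_enum.
rewrite bigcup_seq; have : {subset enum (jfaces D n) <= jfaces D n}.
  by move=> c; rewrite mem_enum.
elim: (enum _) => [_|c s ih sn]; first by rewrite big_nil; exact: continuous_subspace0.
have cn : c \in jfaces D n by apply: sn; rewrite mem_head.
have s'n : {subset s <= jfaces D n} by move=> d ds; apply: sn; rewrite inE ds orbT.
rewrite big_cons; apply: withinU_continuous.
- exact: hat_closed.
- by apply: closed_bigsetU => d ds; apply: hat_closed; exact: s'n.
- apply: (@subspace_eq_continuous _ _ _ (peval (P c))).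
    by move=> x; rewrite inE => /(fP c x cn).
  by apply: continuous_subspaceT; exact: peval_continuous.
exact: ih.
Qed.

(* Two disjoint [n]-faces are only related through the connectedness of the
   polyhedron: the [n]-faces on which [P] has the value of [P c] form a clopen
   subset of it. *)
Lemma connected_ind (T : Type) (P : {set D} -> T) : pure D -> connected (polyhedron D) ->
  (forall c c', c \in jfaces D n -> c' \in jfaces D n -> c :&: c' != finset.set0 ->
     P c = P c') ->
  forall c c', c \in jfaces D n -> c' \in jfaces D n -> P c = P c'.
Proof.
move=> pD cD Pn c c' cn cn'.
(* Faces with a common point share a vertex, since their intersection is the hull of the common
   vertices. *)
have meet d d' y : d \in jfaces D n -> d' \in jfaces D n ->
    simplex d y -> simplex d' y -> P d = P d'.
  move=> dn dn' yd yd'; apply: Pn => //; apply/eqP => dd'.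
  move: (dn) (dn'); rewrite !jfacesE => /andP[dF _] /andP[dF' _].
  have : (simplex d `&` simplex d') y by [].
  by rewrite /simplex faces_inter // dd' => /simplex_set0.
pose U (X : set {set D}) := \bigcup_(d in [set` jfaces D n] `&` X) simplex d.
have clU X : closed (U X).
  by by apply: closed_bigcup => [|d [dn _]]; [exact: finite_finset | exact: simplex_closed].
pose X := [set d | P d = P c].
have sepU : U X `&` U (~` X) = set0.
  apply/seteqP; split=> // y [[d [dn dX] yd] [d' [dn' dX'] yd']].
  by apply: dX'; rewrite /X /= -(meet d d' y).
have sep : separated (U X) (U (~` X)).
  by rewrite /separated -!(closure_id _).1.
have sub : polyhedron D `<=` U X `|` U (~` X).
  rewrite polyhedronE // => y [d dn yd].
  by have [dX|dX] := pselect (X d); [left|right]; exists d.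
have inX d : d \in jfaces D n -> exists2 y, simplex d y & polyhedron D y.
  move=> dn; move: (dn); rewrite jfacesE => /andP[/faces_neq0/finset.set0Pn[v vd] _].
  exists (pos v); first exact: simplex_vertex.
  by rewrite polyhedronE //; exists d => //; exact: simplex_vertex.
have [|/(_ _)UX] := connected_subset sep sub cD; last first.
  have [y yc yD] := inX c cn; have : (U X `&` U (~` X)) y.
    by split; [exists c | exact: UX].
  by rewrite sepU.
move=> UX; have [y yc' yD] := inX c' cn'.
have [d [dn dX] yd] := UX y yD.
by rewrite -dX; exact: meet yd yc'.
Qed.

End Complex.

(** * Splines and the kernel *)

Section SplineKernel.
Variables (R : realType) (n i : nat) (D : simplicial_complex R n).
Variables (r : int_face D n.-1 -> nat) (s : face D i -> nat).
Local Notation S := (mpoly n.+1 R).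
Variable l : int_face D n.-1 -> S.
Hypothesis n_gt0 : (0 < n)%N.
Hypotheses (pD : pure D) (hD : hereditary D) (cD : connected (polyhedron D)).
Hypothesis lP : forall t : int_face D n.-1,
  [/\ l t \is ishomog1 1 mdeg, l t != 0 & forall x, hat (val t) x -> peval (l t) x = 0].

Lemma int_face_jfaces (t : int_face D n.-1) : val t \in jfaces D n.-1.
Proof. by have := valP t; rewrite inE => /andP[]. Qed.

Lemma face_faces j (b : face D j) : val b \in faces D.
Proof. by have := valP b; rewrite jfacesE => /andP[]. Qed.

Lemma J_vanishesP (t : int_face D n.-1) (q : S) :
  reflect ((forall x, hat (val t) x -> vanishes (r t).+1 x q) /\
           forall b : face D i, val b \subset val t ->
             forall x, hat (val b) x -> vanishes (s b).+1 x q)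
          (q \in J r s l t).
Proof.
have [lh l0 lx] := lP t.
apply: (iffP (asboolP _)) => [[ql qm]|[ql qm]]; split.
- by move=> x xt; apply: ideal_span_X_vanishes ql _; exact: lx.
- by move=> b bt x xb; apply: ideal_pow_mhat_vanishes (qm b bt) xb; exact: face_faces.
(* A coface of [t] supplies the vertex along which to project. *)
- have [c [c' [cn _ _ ct _]]] := int_jfaces_cofaces n_gt0 pD (valP t).
  apply: (vanishes_ideal_span_X n_gt0 cn (int_face_jfaces t)) => //.
  by rewrite -ct finset.subsetIl.
- by move=> b bt; apply: vanishes_ideal_pow_mhat (qm b bt); exact: face_faces.
Qed.

Lemma int_face_neq (t : int_face D n.-1) c c' : c \in jfaces D n ->
  c :&: c' = val t -> c != c'.
Proof.
move=> cn cct; apply/eqP => cc'; move: cn (int_face_jfaces t); rewrite -cct -cc' finset.setIid.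
rewrite !jfacesE => /andP[_ /eqP ->] /andP[_]; rewrite prednK // => /eqP[].
by move/eqP; rewrite -[X in _ == X]add0n -[X in X == _]add1n eqn_add2r.
Qed.

Lemma coface_cases (t : int_face D n.-1) c c' d : c \in jfaces D n ->
  c' \in jfaces D n -> c :&: c' = val t -> d \in jfaces D n -> val t \subset d ->
  (d == c) || (d == c').
Proof.
move=> cn cn' cct dn td; have cc' := int_face_neq cn cct.
have [e [e' [_ _ _ _ eP]]] := int_jfaces_cofaces n_gt0 pD (valP t).
have := eP _ cn; rewrite -{1}cct finset.subsetIl => /(_ isT) /orP cE.
have := eP _ cn'; rewrite -{1}cct finset.subsetIr => /(_ isT) /orP cE'.
have /orP dE := eP _ dn td.
by case: cE cE' dE cc' => /eqP -> [] /eqP -> [] /eqP ->; rewrite ?eqxx ?orbT.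
Qed.

(** Only the two cofaces of [t] contribute, with opposite incidence numbers. *)
Lemma rel_boundaryE (f : {ffun face D n -> S^o}) (t : int_face D n.-1) (c c' : face D n) :
  c != c' -> val c :&: val c' = val t ->
  rel_boundary f t = mpolyC n.+1 (incidence (val c) (val t)) * (f c - f c' : S).
Proof.
move=> cc' cct.
have tc : val t \subset val c by rewrite -cct finset.subsetIl.
have tc' : val t \subset val c' by rewrite -cct finset.subsetIr.
have [_ incE] := incidence_opp n_gt0 (int_face_jfaces t) (valP c) (valP c') tc tc' cc'.
rewrite /rel_boundary (bigD1 c) //= (bigD1 c') 1?eq_sym //= big1 ?addr0.
  by rewrite incE mpolyCN mulNr mulrBr.
move=> e /andP[ec ec']; suff te : ~~ (val t \subset val e).
  by rewrite /incidence (negPf te) mpolyC0 mul0r.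
apply: contra ec' => te; have := coface_cases (valP c) (valP c') cct (valP e) te.
by rewrite !(inj_eq val_inj) (negPf ec).
Qed.

(** The kernel condition as orders of vanishing; [P] takes arbitrary vertex sets, so that chains of
    faces can be followed without membership proofs in the index. *)
Definition compatible (P : {set D} -> S) := forall (t : int_face D n.-1) c c',
  c \in jfaces D n -> c' \in jfaces D n -> c :&: c' = val t ->
  (forall x, hat (val t) x -> vanishes (r t).+1 x (P c - P c')) /\
  forall b : face D i, val b \subset val t ->
    forall x, hat (val b) x -> vanishes (s b).+1 x (P c - P c').

Definition extend (f : {ffun face D n -> S^o}) (c : {set D}) : S :=
  if insub c is Some c' then f c' else 0.

Lemma extend_val f (c : face D n) : extend f (val c) = f c.
Proof. by rewrite /extend valK. Qed.

Lemma bdry_ker_compatible (f : {ffun face D n -> S^o}) :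
  f \in bdry_ker r s l <-> compatible (extend f).
Proof.
split=> [/bdry_kerP fk t c c' cn cn' cct|fc].
  have cc' := int_face_neq cn cct.
  pose C : face D n := exist _ c cn; pose C' : face D n := exist _ c' cn'.
  rewrite -[c]/(val C) -[c']/(val C') !extend_val.
  apply/J_vanishesP; have := fk t.
  rewrite (@rel_boundaryE f t C C') //.
  (* The incidence number is a nonzero constant, so it can be divided out. *)
  move/(J_mulr (mpolyC n.+1 (incidence c (val t))^-1)).
  have tc : val t \subset c by rewrite -cct finset.subsetIl.
  have tc' : val t \subset c' by rewrite -cct finset.subsetIr.
  have [inc0 _] := incidence_opp n_gt0 (int_face_jfaces t) cn cn' tc tc' cc'.
  by rewrite mulrA -mpolyCM mulVf // mul1r.
apply/bdry_kerP => t.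
have [c [c' [cn cn' cc' cct _]]] := int_jfaces_cofaces n_gt0 pD (valP t).
pose C : face D n := exist _ c cn; pose C' : face D n := exist _ c' cn'.
rewrite (@rel_boundaryE f t C C') //; apply: J_mulr; apply/J_vanishesP.
by rewrite -!extend_val; exact: fc.
Qed.

Lemma cone_starE (t : int_face D n.-1) c c' : c \in jfaces D n -> c' \in jfaces D n ->
  c :&: c' = val t -> cone_star (val t) = hat c `|` hat c'.
Proof.
move=> cn cn' cct; apply/seteqP; split=> x.
  move=> [e [en te] xe].
  by case/orP: (coface_cases cn cn' cct en te) => /eqP <-; [left|right].
by case=> xc; [exists c | exists c'] => //=; rewrite -cct; split=> //;
  [exact: finset.subsetIl | exact: finset.subsetIr].
Qed.

Lemma spline_compatible (f : real_fun R n) (P : {set D} -> S) : is_spline r s f ->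
  (forall c x, c \in jfaces D n -> hat c x -> f x = peval (P c) x) -> compatible P.
Proof.
move=> [_ _ Cf [p pf ps]] Pf t c c' cn cn' cct.
(* The polynomial on an [n]-face is determined by [f], so the supersmoothness of [p] applies to
   [P]. *)
have pP (e : face D n) : p e = P (val e).
  by apply: (peval_hat_inj (valP e)) => x xe; rewrite -pf // -Pf //; exact: valP.
split=> [x|b bt x xb].
  have := Cf t; rewrite (cone_starE cn cn' cct) => Cft.
  rewrite -cct => xt; apply: (Ck_on_mderivm Cft (C1 := hat c) (C2 := hat c')) => //.
  - exact: hat_closure.
  - exact: hat_closure.
  - by move=> y; exact: Pf.
  - by move=> y; exact: Pf.
  - by apply: hat_sub xt; exact: finset.subsetIl.
  - by apply: hat_sub xt; exact: finset.subsetIr.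
move=> a ab; rewrite mderivmB pevalB; apply/eqP; rewrite subr_eq0; apply/eqP.
pose C : face D n := exist _ c cn; pose C' : face D n := exist _ c' cn'.
rewrite -[c]/(val C) -[c']/(val C') -!pP; apply: (ps b) => //.
- by apply: fintype.subset_trans bt _; rewrite -cct finset.subsetIl.
- by apply: fintype.subset_trans bt _; rewrite -cct finset.subsetIr.
Qed.

Lemma vanishes0 d (x : 'rV[R]_n.+1) : vanishes d x (0 : S).
Proof. by move=> a _; rewrite raddf0 /peval meval0. Qed.

(** This makes the glued function well defined. For faces that meet, the values agree along a chain
    whose facets all have the point in their cone. *)
Lemma compatible_hat (P : {set D} -> S) c c' x : compatible P ->
  c \in jfaces D n -> c' \in jfaces D n ->
  hat c x -> hat c' x -> peval (P c) x = peval (P c') x.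
Proof.
move=> cP; have meet d d' y : d \in jfaces D n -> d' \in jfaces D n ->
    d :&: d' != finset.set0 -> hat (d :&: d') y -> peval (P d) y = peval (P d') y.
  move=> dn dn' dd' yd.
  apply: (hereditary_ind (Q := fun e e' => peval (P e) y = peval (P e') y) hD dn dn' dd').
  - by [].
  - by move=> e e' e'' -> ->.
  move=> e e' en en' eei dee.
  pose t : int_face D n.-1 := exist (fun b : {set D} => b \in int_jfaces D n.-1) _ eei.
  have [Pv _] := cP t e e' en en' (erefl _).
  have /(_ mnm0) := Pv y (hat_sub dee yd); rewrite mdeg0 mderivm0m pevalB => /(_ isT).
  by move/eqP; rewrite subr_eq0 => /eqP.
move=> cn cn' xc xc'; move: (cn) (cn'); rewrite !jfacesE => /andP[cF _] /andP[cF' _].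
have xI := hat_inter cF cF' xc xc'.
have [cc'|cc'] := eqVneq (c :&: c') finset.set0; last exact: meet.
move: xI; rewrite cc' => /hat_set0 ->.
(* Cones over disjoint faces share only the origin, where the values are compared through
   connectedness. *)
apply: (connected_ind (P := fun e => peval (P e) 0) pD cD) => // e e' en en' ee'.
by apply: meet => //; exact: hat0.
Qed.

Lemma compatible_spline (P : {set D} -> S) : compatible P ->
  exists2 f : real_fun R n, is_spline r s f &
    forall c x, c \in jfaces D n -> hat c x -> f x = peval (P c) x.
Proof.
move=> cP.
pose f : real_fun R n := fun x =>
  if pselect (exists2 c, c \in jfaces D n & hat c x) is left e then
    peval (P (projT1 (cid2 e))) x else 0.
have fP c x : c \in jfaces D n -> hat c x -> f x = peval (P c) x.
  move=> cn xc; rewrite /f; case: pselect => [e|]; last by case; exists c.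
  by case: cid2 => d dn xd /=; exact: compatible_hat.
exists f => //; split.
- by move=> x; rewrite coneE // /f => xD; case: pselect.
- exact: within_cone_continuous fP.
- move=> t; have [c [c' [cn cn' cc' cct _]]] := int_jfaces_cofaces n_gt0 pD (valP t).
  rewrite (cone_starE cn cn' cct); apply: (@Ck_on_paste _ _ _ _ _ _ (P c) (P c')).
  + exact: hat_closed.
  + exact: hat_closed.
  + by move=> x; exact: fP.
  + by move=> x; exact: fP.
  move=> x xc xc'; have [Pv _] := cP t c c' cn cn' cct; apply: Pv.
  move: (cn) (cn'); rewrite !jfacesE => /andP[cF _] /andP[cF' _].
  by rewrite -cct; exact: hat_inter.
exists (fun c => P (val c)); first by move=> c x; apply: fP; exact: valP.
move=> b c c' bc bc' a ab x xb; apply/eqP; rewrite -subr_eq0 -pevalB -mderivmB; apply/eqP.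
have bcc' : val b \subset val c :&: val c' by rewrite finset.subsetI bc.
have cc' : val c :&: val c' != finset.set0.
  apply: contraTneq bcc' => ->; rewrite finset.subset0.
  exact: faces_neq0 (face_faces b).
have : vanishes (s b).+1 x (P (val c) - P (val c')); last by apply.
(* Every facet crossed by the chain contains [val c :&: val c'], hence [b], so each step preserves
   the derivatives on the cone over [b]. *)
apply: (hereditary_ind (Q := fun e e' => vanishes (s b).+1 x (P e - P e'))
  hD (valP c) (valP c') cc').
- by move=> e; rewrite subrr; exact: vanishes0.
- move=> e e' e'' v v'.
  by rewrite -(subrK (P e') (P e)) -addrA; exact: vanishesD.
move=> e e' en en' eei dee.
pose t : int_face D n.-1 := exist (fun b : {set D} => b \in int_jfaces D n.-1) _ eei.
have [_ Pv] := cP t e e' en en' (erefl _).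
by apply: Pv xb; exact: fintype.subset_trans bcc' dee.
Qed.

End SplineKernel.

(** * The isomorphism given by restriction to the cones over the [n]-faces *)

Section Isomorphism.
Variables (R : realType) (n i : nat) (D : simplicial_complex R n).
Variables (r : int_face D n.-1 -> nat) (s : face D i -> nat).
Local Notation S := (mpoly n.+1 R).
Variable l : int_face D n.-1 -> S.
Hypothesis n_gt0 : (0 < n)%N.
Hypotheses (pD : pure D) (hD : hereditary D) (cD : connected (polyhedron D)).
Hypothesis lP : forall t : int_face D n.-1,
  [/\ l t \is ishomog1 1 mdeg, l t != 0 & forall x, hat (val t) x -> peval (l t) x = 0].

(** The graph of the isomorphism: as a relation, it allows existence and uniqueness to be proved
    separately in both directions. *)
Definition restricts (f : spline_space r s) (k : bdry_kernel r s l) :=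
  forall (c : face D n) x, hat (val c) x -> spline_fun f x = peval (bdry_kernel_val k c : S) x.

Lemma restricts_total f : exists k, restricts f k.
Proof.
case: f => f fs; have fS : is_spline r s f := asboolW fs.
have [_ _ _ [p pf _]] := fS.
pose k := [ffun c => p c : S^o].
have kE : k \in bdry_ker r s l.
  apply: (bdry_ker_compatible r s n_gt0 pD lP k).2.
  apply: (spline_compatible n_gt0 pD fS) => c x cn xc.
  pose C : face D n := exist _ c cn.
  by rewrite -[c]/(val C) extend_val ffunE -pf.
by exists (BdryKernel kE) => c x xc; rewrite /= ffunE; exact: pf.
Qed.

Lemma restricts_surj k : exists f, restricts f k.
Proof.
case: k => k kE; have kc := (bdry_ker_compatible r s n_gt0 pD lP k).1 kE.
have [f fS fP] := compatible_spline n_gt0 pD hD cD kc.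
exists (SplineSpace (asboolT fS : f \in splines r s)) => c x xc /=.
by rewrite -extend_val; apply: fP => //; exact: valP.
Qed.

Lemma restricts_fun f k k' : restricts f k -> restricts f k' -> k = k'.
Proof.
move=> fk fk'; apply: val_inj; apply/ffunP => c.
apply: (peval_hat_inj (valP c)) => x xc.
exact: etrans (esym (fk c x xc)) (fk' c x xc).
Qed.

(** The family determines a spline on the cone; off the cone both splines are [0] by convention. *)
Lemma restricts_inj f f' k : restricts f k -> restricts f' k -> f = f'.
Proof.
move=> fk fk'; apply: val_inj; apply/funext => x.
have [f0 _ _ _] : is_spline r s (spline_fun f) by case: f {fk} => g gs; exact: asboolW gs.
have [f0' _ _ _] : is_spline r s (spline_fun f') by case: f' {fk'} => g gs; exact: asboolW gs.
have [|xD] := pselect (cone D x); last by rewrite [LHS]f0 // [RHS]f0'.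
rewrite coneE // => -[c cn xc]; pose C : face D n := exist _ c cn.
by rewrite [LHS](fk C) // [RHS](fk' C).
Qed.

Lemma restricts_linear (p : S) f f' k k' : restricts f k -> restricts f' k' ->
  restricts (p *: f + f') (p *: k + k').
Proof.
move=> fk fk' c x xc.
have -> : spline_fun (p *: f + f') x = peval p x * spline_fun f x + spline_fun f' x by [].
have -> : bdry_kernel_val (p *: k + k') c = p * (bdry_kernel_val k c : S) + bdry_kernel_val k' c.
  by rewrite /= !ffunE.
by rewrite pevalD pevalM (fk c x xc) (fk' c x xc).
Qed.

End Isomorphism.

(* Connectedness is needed: all the cones over the n-faces contain the origin,
   where a spline has one value. If D consists of two disjoint n-simplices, the
   kernel is S + S, but a spline is a pair of polynomials with the same value
   at the origin. *)
Theorem corollary3p6 (R : realType) (n i : nat) (D : simplicial_complex R n)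
    (r : int_face D n.-1 -> nat) (s : face D i -> nat)
    (l : int_face D n.-1 -> mpoly n.+1 R) :
  (i + 2 <= n)%N ->
  pure D -> hereditary D -> connected (polyhedron D) ->
  (forall (t : int_face D n.-1) (b : face D i),
     val b \in int_jfaces D i -> (r t <= s b)%N) ->
  (forall t : int_face D n.-1,
     [/\ l t \is ishomog1 1 mdeg, l t != 0 &
         forall x, hat (val t) x -> peval (l t) x = 0]) ->
  exists Phi : {linear spline_space r s -> bdry_kernel r s l}, bijective Phi.
Proof.
move=> i_n pD hD cD _ lP.
have n_gt0 : (0 < n)%N by apply: leq_trans i_n; rewrite addn2.
have /choice [phi phiP] := restricts_total (r := r) (s := s) n_gt0 pD lP.
have /choice [psi psiP] := restricts_surj (r := r) (s := s) n_gt0 pD hD cD lP.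
have phi_linear : linear phi.
  (* Linearity of the chosen function follows from the uniqueness of the restricted family. *)
  move=> p f f'; apply: restricts_fun (phiP _) _.
  exact: restricts_linear.
pose Phi : {linear spline_space r s -> bdry_kernel r s l} :=
  HB.pack phi (GRing.isLinear.Build _ _ _ _ phi phi_linear).
exists Phi; exists psi => [f|k] /=.
  exact: (restricts_inj pD (psiP _) (phiP f)).
exact: (restricts_fun (phiP _) (psiP k)).
Qed.
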